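(* Let $m\ge 1$ and $n\ge 1$ be integers and let $\{a_k\}_{k\ge 0}$ be a linear recurrence sequence in the cyclotomic field $\mathbb{Q}(\mu_m)$ with dimension $n$, i.e. there are constants $c_1,\dots,c_n\in\mathbb{Q}(\mu_m)$ with $c_n\neq 0$ such that $a_k=\sum_{i=1}^n c_i a_{k-i}$ for all $k\ge n$. Then: (1) There exists a positive integer $s$ with $s\mid R_{m,n}$ such that the set $\{k\ge 0: a_k=0\}$ is the union of a finite set and some (finitely many) arithmetic progressions of the form $i+s\mathbb{N}=\{i+sj: j\ge 0\}$. (2) The sequence of fields $\{\mathbb{Q}(a_k)\}_{k\ge 0}$ is virtually periodic with virtual period $r$ dividing $R_{m,n}$. Moreover, if $N$ denotes its pre-period length, then $\mathbb{Q}(a_k)\subseteq\mathbb{Q}(a_{k'})$ whenever $k,k'\ge 0$ satisfy $k\equiv k'\pmod r$ and $k'\ge N$.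
   Context: A sequence $\{b_k\}_{k\ge 0}$ is called virtually periodic if there exist integers $N,r\ge 1$ with $b_k=b_{k+r}$ for all $k\ge N$; the minimal such $r$ is the virtual period and the minimal such $N$ is the pre-period length. $\mathbb{Q}(\mu_m)$ denotes the field generated over $\mathbb{Q}$ by the $m$-th roots of unity. Definition of $R_{m,n}$: first let $m$ be even. Set $R_{m,1}=m$. For $n>1$, for each prime $p$ define $e_p=0$ if $p\nmid m$ and $p>n+1$; $e_p=1+\lfloor\log_p\frac{n}{p-1}\rfloor$ if $p\nmid m$ and $2<p\le n+1$; $e_p=2+\lfloor\log_2 n\rfloor$ if $p=2$ and $\operatorname{ord}_2(m)=1$; $e_p=\operatorname{ord}_p(m)+\lfloor\log_p n\rfloor$ if $2p\mid m$; and set $R_{m,n}=\prod_p p^{e_p}$. Here $\lfloor x\rfloor$ is the greatest integer $\le x$ and $\operatorname{ord}_p$ is the $p$-adic valuation. For odd $m$, define $R_{m,n}=R_{2m,n}$. *)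

(* Defs.v *)
From mathcomp Require Import all_boot all_order all_algebra all_field.

Set Implicit Arguments.
Unset Strict Implicit.
Unset Printing Implicit Defensive.

Import GRing.Theory.
Local Open Scope ring_scope.

(* Q(mu_m), up to isomorphism: X^m - 1 splits in L, and L is generated over Q
   by its roots, i.e. by all the m-th roots of unity. *)
Definition is_cyclotomic_field (m : nat) (L : fieldExtType rat) : Prop :=
  splittingFieldFor 1%VS ('X^m - 1 : {poly L}) {:L}%VS.

Definition gen_field (L : fieldExtType rat) (x : L) : {subfield L} :=
  <<1; x>>%AS.

Definition linear_recurrence (K : fieldType) (n : nat) (a : nat -> K) : Prop :=
  exists2 c : nat -> K, c n != 0 &
    forall k : nat, (n <= k)%N ->
      a k = \sum_(1 <= i < n.+1) c i * a (k - i)%N.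

Local Open Scope nat_scope.

Definition periodic_from (T : Type) (b : nat -> T) (N r : nat) : Prop :=
  forall k : nat, N <= k -> b k = b (k + r).

Definition virtually_periodic (T : Type) (b : nat -> T) : Prop :=
  exists N r : nat, [/\ 1 <= N, 1 <= r & periodic_from b N r].

Definition is_virtual_period (T : Type) (b : nat -> T) (r : nat) : Prop :=
  let P r' := 1 <= r' /\ exists2 N : nat, 1 <= N & periodic_from b N r' in
  P r /\ forall r' : nat, P r' -> r <= r'.

Definition is_preperiod_length (T : Type) (b : nat -> T) (N : nat) : Prop :=
  let P N' := 1 <= N' /\ exists2 r : nat, 1 <= r & periodic_from b N' r in
  P N /\ forall N' : nat, P N' -> N <= N'.

(* floor (log_p (a / b)) for a >= b > 0 and p > 1; see floor_log_quotP. *)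
Definition floor_log_quot (p a b : nat) : nat := trunc_log p (a %/ b).

Lemma floor_log_quotP (p a b e : nat) :
  1 < p -> 0 < b <= a -> (e <= floor_log_quot p a b) = (p ^ e * b <= a).
Proof.
move=> p1 /andP[b0 ba]; rewrite -leq_divRL // /floor_log_quot.
have q0 : 0 < a %/ b by rewrite divn_gt0.
apply/idP/idP => [le_e|]; last exact: trunc_log_max.
by apply: leq_trans (trunc_logP p1 q0); rewrite leq_exp2l.
Qed.

(* For even m and prime p the four tests are exhaustive. *)
Definition R_exponent (m n p : nat) : nat :=
  if ~~ (p %| m) && (n + 1 < p) then 0
  else if ~~ (p %| m) && (2 < p <= n + 1) then
    1 + floor_log_quot p n (p - 1)
  else if (p == 2) && (logn 2 m == 1) then 2 + trunc_log 2 n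
  else if 2 * p %| m then logn p m + trunc_log p n
  else 0.

(* For m > 0 every prime p with a nonzero exponent divides m or is at most
   n + 1, so the bounded product is the product over all primes. *)
Definition R_even (m n : nat) : nat :=
  if n == 1 then m
  else \prod_(0 <= p < m + n + 2 | prime p) p ^ R_exponent m n p.

Definition R_number (m n : nat) : nat :=
  if odd m then R_even (2 * m) n else R_even m n.

(* Main.v *)
(* Let h be the identity of L, or g - 1 for some g in Gal(L/Q); since
   Q(x) <= Q(y) iff every g fixing y fixes x, both claims say that h (a_(i + R j))
   vanishes for finitely many j or for all j.

   (1) For some M this holds for h (a_(i + M j)).  On a Q-vector space of states
   the recurrence is an invertible matrix A, which after clearing denominators
   satisfies A^M = 1 + p^2 B over Z for a prime p not dividing det A.  So the
   subsequence is sum_k C(j, k) p^(2k) w_k, a polynomial in j with highly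
   p-divisible coefficients once finitely many j are considered; dividing out s
   zeros shows that all of its values are divisible by p^s.

   (2) From M to R: a sequence annihilated by prod (X - r_i), whose subsequence
   along R M N vanishes, also vanishes along R N as soon as
   r_i^(R M) = r_j^(R M) implies r_i^R = r_j^R.

   (3) This implication holds for numbers of degree at most n over Q(mu_m).  Raising
   to a power, let alpha and zeta alpha be such numbers, with zeta of order p^e.
   Let s be an automorphism of algC that fixes mu_m and maps zeta to zeta^u; then
   s^x alpha = alpha and s^y (zeta alpha) = zeta alpha for some x, y <= n, so
   u^lcm(x, y) = 1 mod p^e.  If u has p-power order this order divides x or y.
   If p does not divide m, take u of order (p - 1) p^(e-1): as s^x and s^y commute,
   p^e | (u^x - 1)(u^y - 1), so if p - 1 does not divide x then u^y = 1 mod p^e, and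
   likewise with x and y exchanged; if p - 1 divides both, then use that p^(e-1)
   divides lcm(x, y), hence x or y. *)
Require Import Defs.
From HB Require Import structures.
From mathcomp Require Import all_boot all_order all_fingroup all_algebra.
From mathcomp Require Import all_solvable all_field.
From mathcomp Require Import zify ring.
From Stdlib Require Import Classical.

Set Implicit Arguments.
Unset Strict Implicit.
Unset Printing Implicit Defensive.

Import Order.TTheory GRing.Theory Num.Theory VectorInternalTheory.
Local Open Scope ring_scope.

(** * Zeros of p-adically convergent binomial series *)

Lemma PoszX (a k : nat) : (a ^ k)%N%:Z = a%:Z ^+ k.
Proof. by elim: k => // k IH; rewrite expnS exprS PoszM IH. Qed.

Lemma logn_fact_leq p k : prime p -> (logn p k`! <= k)%N.
Proof.
move=> p_pr; rewrite logn_fact //.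
suff H K : ((\sum_(1 <= i < K.+1) k %/ p ^ i)%N + k %/ p ^ K <= k)%N.
  exact: leq_trans (leq_addr _ _) (H k).
elim: K => [|K IH]; first by rewrite big_geq // expn0 divn1.
rewrite big_nat_recr //=; apply: leq_trans IH; rewrite -addnA leq_add2l.
rewrite expnSr divnMA addnn -muln2.
apply: leq_trans (leq_divM _ p); rewrite leq_mul2l prime_gt1 // orbT //.
Qed.

(* Dividing out a root t shifts the divisibility pattern d * p ^ i %| G`_i by
   one step, since Q`_i = G`_i.+1 + t * Q`_i.+1. *)
Lemma dvdz_coef_divX (d p t : int) (Q : {poly int}) :
  (forall i, (d * p ^+ i %| (Q * ('X - t%:P))`_i)%Z) ->
  forall i, (d * p * p ^+ i %| Q`_i)%Z.
Proof.
move=> H i; rewrite -mulrA -exprS.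
move: {2}(size Q - i)%N (leqnn (size Q - i)%N) => k.
elim: k i => [|k IH] i Hk.
  by rewrite nth_default ?dvdz0 // -subn_eq0 -leqn0.
have := H i.+1; rewrite mulrBr coefB coefMX coefMC /= => H1.
have H2 : (d * p ^+ i.+1 %| Q`_i.+1)%Z.
  apply: dvdz_trans (IH i.+1 _); last by move: Hk; lia.
  by rewrite dvdz_mul // dvdz_exp2l.
by rewrite -(subrK (Q`_i.+1 * t) Q`_i) rpredD // dvdz_mulr.
Qed.

(** Induction on the roots: by [dvdz_coef_divX], each factor ['X - t%:P] divided out lets [d * p]
    take the place of [d]. With no roots left, all coefficients are divisible by [d]. *)
Lemma dvdz_horner_roots (d p : int) (G : {poly int}) (ts : seq int) :
  (forall i, (d * p ^+ i %| G`_i)%Z) -> uniq ts -> all (root G) ts ->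
  forall x, (d * p ^+ size ts %| G.[x])%Z.
Proof.
elim: ts d G => [|t ts IH] d G HG /=.
  move=> _ _ x; rewrite expr0 mulr1 horner_coef rpred_sum // => i _.
  rewrite dvdz_mulr // (dvdz_trans _ (HG i)) // dvdz_mulr //.
case/andP=> tts uts /andP[/factor_theorem[Q DQ] rts] x.
rewrite {}DQ in HG rts *; rewrite hornerM dvdz_mulr // exprS mulrA.
apply: IH => //; first exact: dvdz_coef_divX HG.
apply/allP=> t' t'ts; have := allP rts _ t'ts; rewrite rootM root_XsubC.
by case: eqP t'ts tts => [-> -> //|_ _ _]; rewrite orbF.
Qed.

(** Stopping at [k = j] loses nothing, since ['C(j, k)] vanishes for larger [k]. This is the whole
    Mahler series with coefficients [q ^+ k * w k], evaluated at a natural number. *)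
Definition binom_series (q : int) (w : nat -> int) (j : nat) : int :=
  \sum_(k < j.+1) 'C(j, k)%:R * q ^+ k * w k.

Lemma binom_series_widen q w j K : (j <= K)%N ->
  binom_series q w j = \sum_(k < K.+1) 'C(j, k)%:R * q ^+ k * w k.
Proof.
move=> jK; rewrite /binom_series (big_ord_widen K.+1
  (fun k => 'C(j, k)%:R * q ^+ k * w k)) ?ltnS //.
rewrite [RHS](bigID (fun i : 'I_K.+1 => (i < j.+1)%N)) /=.
rewrite [X in _ + X]big1 ?addr0 // => i; rewrite -leqNgt => ji.
by rewrite bin_small // !mul0r.
Qed.

Definition ffact_poly (k : nat) : {poly int} := \prod_(i < k) ('X - (i : nat)%:Z%:P).

Lemma ffact_polyE k j : (ffact_poly k).[j%:Z] = (j ^_ k)%:Z.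
Proof.
elim: k => [|k IH]; first by rewrite /ffact_poly big_ord0 hornerC ffactn0.
rewrite /ffact_poly big_ord_recr /= hornerM -/(ffact_poly k) IH ffactnSr.
rewrite hornerXsubC PoszM.
have [kj|jk] := leqP k j; first by rewrite subzn.
by rewrite ffact_small // !mul0r.
Qed.

Lemma size_ffact_poly k : size (ffact_poly k) = k.+1.
Proof. by rewrite size_prod_XsubC /index_enum -enumT size_enum_ord. Qed.

(** On arguments up to K, the series times K! is an integer polynomial G, a combination of falling
    factorials with coefficients (K!/k!) p^(2k) w_k. As ord_p(k!) <= k, the square in the base
    leaves a factor p^k to spare: the k-th coefficient is divisible by p^(ord_p(K!) + k), which is
    the pattern required by [dvdz_horner_roots]. *)
Lemma binom_series_zeros (p : nat) (w : nat -> int) (ts : seq nat) (n : nat) :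
  prime p -> uniq ts -> (forall t, t \in ts -> binom_series (p ^ 2)%N%:Z w t = 0) ->
  (p%:Z ^+ size ts %| binom_series (p ^ 2)%N%:Z w n)%Z.
Proof.
move=> p_pr uts zts.
have [K nK tK] : exists2 K, (n <= K)%N & forall t, t \in ts -> (t <= K)%N.
  exists (n + \sum_(t <- ts) t)%N => [|t t_ts]; first exact: leq_addr.
  by rewrite (big_rem t) //=; lia.
have fact_dvd (k : 'I_K.+1) : (k`! %| K`!)%N.
  by rewrite -(bin_fact (ltn_ord k : k <= K)%N) mulnCA dvdn_mulr.
pose G : {poly int} := \sum_(k < K.+1)
  ((K`! %/ k`!)%N%:Z * (p ^ 2)%N%:Z ^+ k * w k) *: ffact_poly k.
have GE j : (j <= K)%N -> G.[j%:Z] = K`!%:Z * binom_series (p ^ 2)%N%:Z w j.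
  move=> jK; rewrite (binom_series_widen _ _ jK) horner_sum mulr_sumr.
  apply: eq_bigr => k _; rewrite hornerZ ffact_polyE -bin_ffact !mulrA.
  rewrite -{2}(divnK (fact_dvd k)).
  rewrite !PoszM !natz; ring.
pose lam := logn p K`!.
have Gdiv i : ((p ^ lam)%N%:Z * p%:Z ^+ i %| G`_i)%Z.
  rewrite coef_sum rpred_sum // => k _; rewrite coefZ.
  have [ik|ki] := leqP i k; last first.
    by rewrite nth_default ?mulr0 ?dvdz0 // size_ffact_poly.
  apply: dvdz_mulr; apply: dvdz_mulr.
  rewrite -!PoszX -!PoszM dvdzE /= -expnM -expnD.
  have kf := fact_dvd k; have Kk_gt0 : (0 < K`! %/ k`!)%N.
    by rewrite (divn_gt0 _ (fact_gt0 k)) (dvdn_leq (fact_gt0 K) kf).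
  have pk_gt0 : (0 < p ^ (2 * k))%N by rewrite expn_gt0 prime_gt0.
  rewrite pfactor_dvdn ?muln_gt0 ?Kk_gt0 // (lognM _ Kk_gt0 pk_gt0).
  rewrite logn_div // -/lam pfactorK //.
  have := dvdn_leq_log p (fact_gt0 K) kf; rewrite -/lam.
  by have := logn_fact_leq k p_pr; lia.
have := @dvdz_horner_roots _ _ G (map Posz ts) Gdiv.
rewrite map_inj_uniq; last by move=> ? ? [].
rewrite all_map size_map => /(_ uts) H.
have {}H : ((p ^ lam)%N%:Z * p%:Z ^+ size ts %| G.[n%:Z])%Z.
  apply: H; apply/allP => t t_ts /=; rewrite /root GE ?tK // zts // mulr0 //.
rewrite GE // in H.
(* The p-part of K! cancels against p^lam, and the remaining factor of K! is coprime to p. *)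
move: H; rewrite -(partnC p (fact_gt0 K)) p_part -/lam PoszM -mulrA dvdz_mul2l; last first.
  by rewrite eqz_nat -lt0n expn_gt0 prime_gt0.
rewrite -PoszX Gauss_dvdzr // coprimezE /=.
by rewrite coprimeXl // (@pnat_coprime p) ?part_pnat // pnat_id.
Qed.

Definition fin_or_all (P : nat -> Prop) : Prop :=
  (forall j, P j) \/ exists B, forall j, P j -> (j <= B)%N.

Lemma fin_or_all_iff (P Q : nat -> Prop) :
  (forall j, P j <-> Q j) -> fin_or_all P -> fin_or_all Q.
Proof.
move=> PQ [allP|[B HB]]; [left=> j | right; exists B => j]; rewrite -PQ //.
exact: HB.
Qed.

Lemma unbounded_uniq_seq (P : nat -> Prop) s :
  ~ (exists B, forall j, P j -> (j <= B)%N) ->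
  exists ts, [/\ uniq ts, size ts = s & forall t, t \in ts -> P t].
Proof.
move=> unb; elim: s => [|s [ts [uts <- Pts]]]; first by exists [::].
have [t Pt tts] : exists2 t, P t & (\sum_(i <- ts) i < t)%N.
  apply: NNPP => noE; apply: unb; exists (\sum_(i <- ts) i)%N => j Pj.
  by rewrite leqNgt; apply/negP => lt_j; apply: noE; exists j.
exists (t :: ts); split=> //=; last by move=> x; rewrite inE => /predU1P[-> //|/Pts].
rewrite uts andbT; apply: contraL tts => t_ts.
by rewrite -leqNgt (big_rem t) //= leq_addr.
Qed.

(** If v is a nonzero value, |v| distinct zeros make p^|v| divide v, which is impossible because |v|
    < p^|v|. *)
Lemma binom_series_fin_or_all (p : nat) (w : nat -> int) :
  prime p -> fin_or_all (fun t => binom_series (p ^ 2)%N%:Z w t = 0).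
Proof.
move=> p_pr; case: (classic (exists B, forall t,
  binom_series (p ^ 2)%N%:Z w t = 0 -> (t <= B)%N)) => [|unb]; first by right.
left=> n; set v := binom_series _ _ _; apply/eqP/negPn/negP => nz_v.
have [ts [uts sz_ts zts]] := unbounded_uniq_seq `|v|%N unb.
have := binom_series_zeros n p_pr uts zts; rewrite -/v sz_ts dvdzE abszX /=.
move/(dvdn_leq _); rewrite absz_gt0 nz_v => /(_ isT).
by rewrite leqNgt ltn_expl // prime_gt1.
Qed.

(** * The Skolem property of linear recurrences over a number field *)

Lemma intr_Zp_eq0 (q : nat) (x : int) : (1 < q)%N ->
  (x%:~R == 0 :> 'Z_q) = (q%:Z %| x)%Z.
Proof.
move=> q1; have natE (k : nat) : (k%:R == 0 :> 'Z_q) = (q %| k)%N.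
  by rewrite -val_eqE /= val_Zp_nat.
by case: (intP x) => [|k|k]; rewrite ?mulrNz ?oppr_eq0 -?pmulrn natE dvdzE ?abszN.
Qed.

Lemma unit_intr_Zp (q : nat) (x : int) : (1 < q)%N -> coprime q `|x|%N ->
  (x%:~R : 'Z_q) \is a GRing.unit.
Proof.
move=> q1 co; have natE (k : nat) : coprime q k -> k%:R \is a @GRing.unit 'Z_q.
  by rewrite unitZpE.
by case: (intP x) co => [|k|k] co; rewrite ?mulrNz ?unitrN -?pmulrn natE // -?abszN.
Qed.

(** Reduced modulo q, the matrix is a unit of a finite ring; M is its order there. *)
Lemma int_mx_pow_eq1 (d q : nat) (A : 'M[int]_d.+1) :
  (1 < q)%N -> coprime q `|\det A|%N ->
  exists2 M, (0 < M)%N & exists B : 'M[int]_d.+1, A ^+ M = 1 + q%:Z *: B.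
Proof.
move=> q1 co; pose rA : 'M['Z_q]_d.+1 := map_mx intr A.
have uA : rA \is a GRing.unit.
  by rewrite -[_ \is a _]/(_ \in unitmx) unitmxE det_map_mx unit_intr_Zp.
pose g := FinRing.unit 'M['Z_q]_d.+1 uA.
exists #[g]%g; first exact: order_gt0.
have AM : map_mx intr (A ^+ #[g]%g) = 1 :> 'M['Z_q]_d.+1.
  by rewrite rmorphXn /= -/rA -[rA]/(val g) -FinRing.val_unitX expg_order.
exists (map_mx (fun x => (x %/ q%:Z)%Z) (A ^+ #[g]%g - 1)).
apply/eqP; rewrite addrC -subr_eq; apply/eqP/matrixP => i j.
rewrite !mxE mulrC divzK //.
rewrite -intr_Zp_eq0 // rmorphB /= subr_eq0; apply/eqP.
have /matrixP/(_ i j) := AM; rewrite !mxE => ->.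
by case: (_ == _).
Qed.

(** Any prime above |det A| is coprime to it. Writing A^M = 1 + p^2 B and expanding A^(i + M j) by
    the binomial formula gives a binomial series with coefficients x A^i B^k y. *)
Lemma int_mx_skolem (d : nat) (A : 'M[int]_d.+1) : \det A != 0 ->
  exists2 M, (0 < M)%N & forall (x : 'rV_d.+1) (y : 'cV_d.+1) i,
    fin_or_all (fun j => (x *m A ^+ (i + M * j) *m y) 0 0 = 0).
Proof.
move=> nzA; have [p lt_p p_pr] := prime_above `|\det A|%N.
have co : coprime (p ^ 2) `|\det A|%N.
  rewrite coprimeXl // prime_coprime //; apply: contraTN lt_p => /dvdn_leq.
  by rewrite absz_gt0 nzA -leqNgt; apply.
have [|M M0 [B DB]] := @int_mx_pow_eq1 _ (p ^ 2)%N A _ co.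
  by rewrite (ltn_exp2l 0) ?prime_gt1.
exists M => // x y i.
have E j : (x *m A ^+ (i + M * j) *m y) 0 0 =
    binom_series (p ^ 2)%N%:Z (fun k => (x *m A ^+ i *m B ^+ k *m y) 0 0) j.
  rewrite exprD exprM DB exprDn_comm; last by rewrite /GRing.comm mul1r mulr1.
  rewrite mulr_sumr mulmx_sumr mulmx_suml summxE; apply: eq_bigr => k _.
  rewrite expr1n mul1r exprZn -scaler_nat scalerA -scalerAr -scalemxAr.
  by rewrite -scalemxAl mxE -[A ^+ i * _]/(A ^+ i *m _) mulmxA.
apply: fin_or_all_iff (binom_series_fin_or_all
  (fun k => (x *m A ^+ i *m B ^+ k *m y) 0 0) p_pr) => j.
by rewrite E.
Qed.

Lemma rat_mx_denom (m n : nat) (A : 'M[rat]_(m, n)) :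
  exists2 c : int, c != 0 & exists A0 : 'M[int]_(m, n), c%:~R *: A = map_mx intr A0.
Proof.
pose c := \prod_i \prod_j denq (A i j).
exists c; first by apply/prodf_neq0 => i _; apply/prodf_neq0 => j _; apply: denq_neq0.
exists (map_mx (fun x => numq (c%:~R * x)) A); apply/matrixP => i j; rewrite !mxE.
rewrite /c (bigD1 i) //= (bigD1 j) //=.
set b := \prod_(_ | _) _; set b' := \prod_(_ | _) _.
have -> : (denq (A i j) * b * b')%:~R * A i j = (numq (A i j) * b * b')%:~R.
  by rewrite !intrM numqE; ring.
by rewrite numq_int.
Qed.

(** Clearing the denominators of x, A and y multiplies the k-th value by a c^k b, which is nonzero,
    so the zeros stay the same. *)
Lemma rat_mx_skolem (d : nat) (A : 'M[rat]_d.+1) : A \in unitmx ->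
  exists2 M, (0 < M)%N & forall (x : 'rV_d.+1) (y : 'cV_d.+1) i,
    fin_or_all (fun j => (x *m A ^+ (i + M * j) *m y) 0 0 = 0).
Proof.
move=> uA; have [c nz_c [A0 DA]] := rat_mx_denom A.
have cQ : c%:~R != 0 :> rat by rewrite intr_eq0.
have [|M M0 HM] := @int_mx_skolem _ A0.
  have := congr1 determinant DA; rewrite detZ det_map_mx => /esym D.
  rewrite -(intr_eq0 rat) D mulf_neq0 ?expf_neq0 //.
exists M => // x y i.
have [a nz_a [x0 Dx]] := rat_mx_denom x; have [b nz_b [y0 Dy]] := rat_mx_denom y.
have E k : ((x *m A ^+ k *m y) 0 0 = 0) <-> ((x0 *m A0 ^+ k *m y0) 0 0 = 0).
  have D : (a * c ^+ k * b)%:~R * (x *m A ^+ k *m y) 0 0 =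
      ((x0 *m A0 ^+ k *m y0) 0 0)%:~R.
    transitivity ((map_mx intr (x0 *m A0 ^+ k *m y0) : 'M[rat]_1) 0 0).
      2: by rewrite mxE.
    rewrite !map_mxM rmorphXn /= -Dx -DA -Dy exprZn.
    rewrite -!scalemxAl -!scalemxAr !scalerA -!scalemxAl.
    by rewrite !mxE !intrM rmorphXn /=; ring.
  have nz : (a * c ^+ k * b)%:~R != 0 :> rat by rewrite intr_eq0 !mulf_neq0 ?expf_neq0.
  split=> [z|z]; move/eqP: D; rewrite z ?mulr0.
    by rewrite eq_sym intr_eq0 => /eqP.
  by rewrite mulf_eq0 (negPf nz) => /eqP.
by apply: fin_or_all_iff (HM x0 y0 i) => j; rewrite E.
Qed.

Lemma fin_or_all_forall (I : finType) (P : I -> nat -> Prop) :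
  (forall i, fin_or_all (P i)) -> fin_or_all (fun j => forall i, P i j).
Proof.
move=> HP; case: (classic (forall i j, P i j)) => [allP|]; first by left=> j i.
move=> /not_all_ex_not[i nPi]; right; case: (HP i) => // -[B HB].
by exists B => j Pj; apply: HB.
Qed.

Lemma iter_mulmx_skolem (d : nat) (A : 'M[rat]_d) : A \in unitmx ->
  exists2 M, (0 < M)%N & forall (x : 'rV_d) (y : 'cV_d) i,
    fin_or_all (fun j => (iter (i + M * j) (mulmxr A) x *m y) 0 0 = 0).
Proof.
(* Powers of A as ring elements require a positive dimension, so dimension 0 is split off. *)
case: d A => [|d] A uA.
  by exists 1%N => // x y i; left=> j; rewrite [y]flatmx0 mulmx0 mxE.
have [M M0 HM] := rat_mx_skolem uA; exists M => // x y i.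
have E k : iter k (mulmxr A) x = x *m A ^+ k.
  elim: k => [|k IH]; first by rewrite mulmx1.
  by rewrite iterS IH exprSr -[A ^+ k * A]/(A ^+ k *m A) mulmxA.
by apply: fin_or_all_iff (HM x y i) => j; rewrite E.
Qed.

(** In coordinates, the vanishing of [h] is a finite conjunction of scalar equations, one for each
    column of its matrix, and the dichotomy is stable under finite conjunctions. *)
Lemma vect_skolem (V : vectType rat) (T : 'End(V)) : lker T = 0%VS ->
  exists2 M, (0 < M)%N & forall (v : V) (W : vectType rat) (h : 'Hom(V, W)) i,
    fin_or_all (fun j => h (iter (i + M * j) T v) = 0).
Proof.
move=> kT; pose A := lin1_mx (v2r \o T \o r2v).
have AE v : v2r v *m A = v2r (T v) by rewrite mul_rV_lin1 /= v2rK.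
have [|M M0 HM] := @iter_mulmx_skolem _ A.
  rewrite -row_free_unit; apply: inj_row_free => u; rewrite -[u]r2vK AE => Tu0.
  have : r2v u \in lker T by rewrite memv_ker; apply/eqP/v2r_inj; rewrite linear0.
  by rewrite kT memv0 => /eqP->; rewrite linear0.
exists M => // v W h i; pose Y := lin1_mx (v2r \o h \o r2v).
have YE w : v2r w *m Y = v2r (h w) by rewrite mul_rV_lin1 /= v2rK.
have itE k : v2r (iter k T v) = iter k (mulmxr A) (v2r v).
  by elim: k => //= k IH; rewrite -AE IH.
apply: fin_or_all_iff (fin_or_all_forall (fun l => HM (v2r v) (col l Y) i)) => j.
rewrite -itE; split=> [z|z l].
  apply/v2r_inj; rewrite linear0 -YE; apply/rowP => l; rewrite [RHS]mxE.
  by have := z l; rewrite colE mulmxA -colE mxE.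
by rewrite colE mulmxA -colE YE z linear0 !mxE.
Qed.

(** * Recurrences as linear maps on windows of consecutive terms *)

Section Companion.

Variables (L : fieldExtType rat) (n : nat) (c : nat -> L).

(** The companion map of a recurrence of order [n.+1]. It is used only as a map over the rationals,
    so that rational matrices suffice although the coefficients lie in [L]. *)
Definition shift_state (s : {ffun 'I_n.+1 -> L}) : {ffun 'I_n.+1 -> L} :=
  [ffun i : 'I_n.+1 => if (i < n)%N then s (inord i.+1)
                       else \sum_(t < n.+1) c t.+1 * s (rev_ord t)].

Fact shift_state_linear : linear shift_state.
Proof.
move=> b s s'; apply/ffunP => i; rewrite !ffunE; case: ifP => _; rewrite ?ffunE //.
rewrite scaler_sumr -big_split /=; apply: eq_bigr => t _; rewrite !ffunE mulrDr.
by rewrite scalerAr.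
Qed.

HB.instance Definition _ := GRing.isLinear.Build rat {ffun 'I_n.+1 -> L}
  {ffun 'I_n.+1 -> L} _ shift_state shift_state_linear.

(** Every entry of the state but the first reappears in its image; once these are zero, the last
    entry of the image is [c n.+1] times the first one. *)
Lemma shift_state_inj s : c n.+1 != 0 -> shift_state s = 0 -> s = 0.
Proof.
move=> nz_c Ts0.
have sS (i : 'I_n.+1) : (0 < i)%N -> s i = 0.
  move=> i0; have := congr1 (fun f : {ffun _} => f (inord i.-1)) Ts0.
  have ilt := ltn_ord i.
  rewrite !ffunE inordK; last by lia.
  rewrite ifT; last by lia.
  by rewrite prednK // inord_val.
apply/ffunP => i; rewrite ffunE; case: (posnP i) => [i0|]; last exact: sS.
have := congr1 (fun f : {ffun _} => f ord_max) Ts0; rewrite !ffunE ltnn.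
rewrite (bigD1 ord_max) //= big1 => [|t nt]; last first.
  rewrite sS ?mulr0 //= subSS; have : (t != n :> nat)%N by [].
  by have := ltn_ord t; lia.
have -> : rev_ord ord_max = i by apply/val_inj; rewrite /= subnn i0.
by rewrite addr0 => /eqP; rewrite mulf_eq0 (negPf nz_c) => /eqP.
Qed.

Definition shift_lfun : 'End({ffun 'I_n.+1 -> L}) := linfun shift_state.

Lemma shift_lfunE s : shift_lfun s = shift_state s.
Proof. exact: lfunE. Qed.

Definition state_head (s : {ffun 'I_n.+1 -> L}) : L := s ord0.

Fact state_head_linear : linear state_head.
Proof. by move=> b s s'; rewrite /state_head !ffunE. Qed.

HB.instance Definition _ := GRing.isLinear.Build rat {ffun 'I_n.+1 -> L} L _
  state_head state_head_linear.

End Companion.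

Lemma linear_recurrence_skolem (L : fieldExtType rat) (n : nat) (a : nat -> L) :
  (0 < n)%N -> linear_recurrence n a ->
  exists2 M, (0 < M)%N & forall (h : 'End(L)) i,
    fin_or_all (fun j => h (a (i + M * j)%N) = 0).
Proof.
case: n => // n _ [c nz_c rec].
pose T := shift_lfun n c.
have [|M M0 HM] := @vect_skolem _ T.
  apply/eqP/lker0P => s s' /eqP; rewrite -subr_eq0 -linearB /= shift_lfunE => /eqP z.
  by apply/eqP; rewrite -subr_eq0; apply/eqP; apply: shift_state_inj z.
exists M => // h i.
pose st k : {ffun 'I_n.+1 -> L} := [ffun t : 'I_n.+1 => a (k + t)%N].
have itE k : iter k T (st 0%N) = st k.
  elim: k => //= k ->; rewrite shift_lfunE; apply/ffunP => t; rewrite !ffunE.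
  case: ltnP => tn; first by rewrite inordK // addSnnS.
  have -> : t = n :> nat by apply/eqP; rewrite eqn_leq tn -ltnS ltn_ord.
  rewrite addSnnS rec ?leq_addl // big_add1 /= big_mkord; apply: eq_bigr => l _.
  by rewrite ffunE /= addnBA // ltn_ord.
pose ev : 'Hom({ffun 'I_n.+1 -> L}, L) := linfun (@state_head L n).
apply: fin_or_all_iff (HM (st 0%N) _ (h \o ev)%VF i) => j.
by rewrite itE comp_lfunE lfunE /= /state_head ffunE addn0.
Qed.

(** * Annihilators and subsequences *)

Lemma coprimep_prod_XsubC (K : fieldType) (H : {poly K}) (rs : seq K) :
  (forall r, r \in rs -> ~~ root H r) -> coprimep H (\prod_(r <- rs) ('X - r%:P)).
Proof.
elim: rs => [|r rs IH] nrH; first by rewrite big_nil coprimep1.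
rewrite big_cons coprimepMr coprimep_XsubC nrH ?mem_head //=.
by apply: IH => r' r'rs; apply: nrH; rewrite inE r'rs orbT.
Qed.

(* With d = r ^+ M, the functional P |-> lam ((X^M - d) P) satisfies the same
   hypotheses for the remaining roots, hence vanishes by induction; as
   (X^M - d) / (X - r) is coprime to the annihilator, X - r kills lam. *)
Lemma functional_vanish (K : fieldType) (M : nat) (rs : seq K)
    (lam : {poly K} -> K) :
  M%:R != 0 :> K ->
  (forall c P Q, lam (c *: P + Q) = c * lam P + lam Q) ->
  (forall r, r \in rs -> r != 0) ->
  {in rs &, injective (fun r => r ^+ M)} ->
  (forall P, lam ((\prod_(r <- rs) ('X - r%:P)) * P) = 0) ->
  (forall j, lam 'X^(M * j) = 0) -> forall P, lam P = 0.
Proof.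
move=> nzM; elim: rs lam => [|r rs IH] lam lin nz inj ann van P.
  by have := ann P; rewrite big_nil mul1r.
have M0 : (0 < M)%N by case: (M) nzM => //; rewrite eqxx.
have lam0 : lam 0 = 0 by have := lin (-1) 0 0; rewrite scaler0 add0r mulN1r addNr.
have lamD A B : lam (A + B) = lam A + lam B by rewrite -[A]scale1r lin mul1r scale1r.
pose d := r ^+ M; pose D : {poly K} := 'X^M - d%:P.
have rs_r : r \in r :: rs := mem_head _ _.
have [H DH] : exists H, D = H * ('X - r%:P).
  by apply/factor_theorem; rewrite /root /D !hornerE subrr.
set G := \prod_(_ <- _) _ in ann.
have GE : G = ('X - r%:P) * \prod_(r <- rs) ('X - r%:P) by rewrite /G big_cons.
have lamDP A : lam (D * A) = 0.
  apply: (IH (fun A => lam (D * A))) => [c B C|r' r'rs|x y xrs yrs|B|j].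
  - by rewrite mulrDr -scalerAr lin.
  - by apply: nz; rewrite inE r'rs orbT.
  - by apply: inj; rewrite inE ?xrs ?yrs orbT.
  - by have := ann (H * B); rewrite GE DH; congr (lam _ = 0); ring.
  rewrite /D mulrBl -exprD -mulnS mul_polyC addrC -scaleNr lin van mulr0 add0r.
  exact: van.
have coHG : coprimep H G.
  apply: coprimep_prod_XsubC => r' r'rs; apply/negP => Hr'.
  have Er : r' = r.
    apply: inj => //; apply/eqP; rewrite -subr_eq0; have : D.[r'] = 0.
      by rewrite DH hornerM (eqP Hr') mul0r.
    by rewrite /D !hornerE => ->.
  (* A root of H at r would make r a double root of X^M - d, but the derivative M r^(M-1) is nonzero
     there. *)
  have := congr1 (fun p : {poly K} => p^`().[r]) DH.
  rewrite /D derivB derivXn derivC derivM derivXsubC subr0 !hornerE hornerMn.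
  rewrite hornerXn subrr mulr0 add0r -Er (eqP Hr') => /eqP.
  rewrite -mulr_natr mulf_eq0 (negPf nzM) orbF expf_eq0.
  by rewrite (negPf (nz _ r'rs)) andbF.
have /Bezout_eq1_coprimepP[[u v] /= uv] := coHG.
have lamX A : lam (('X - r%:P) * A) = 0.
  have -> : ('X - r%:P) * A = D * (u * A) + G * (v * ('X - r%:P) * A).
    by rewrite -[LHS]mul1r -uv DH; ring.
  by rewrite lamD lamDP ann addr0.
have [Q DQ] : exists Q, P - P.[r]%:P = Q * ('X - r%:P).
  by apply/factor_theorem; rewrite /root !hornerE subrr.
rewrite -[P](subrK P.[r]%:P) DQ mulrC lamD lamX add0r -[_%:P]mulr1 mul_polyC.
have lam1 : lam 1 = 0 by have := van 0%N; rewrite muln0.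
by rewrite -[_ *: _]addr0 lin lam0 addr0 lam1 mulr0.
Qed.

(** The linear functional on polynomials with ['X^k] sent to [u k]. A recurrence for [u] then says
    that it kills the ideal generated by the characteristic polynomial. *)
Definition seq_functional (K : fieldType) (u : nat -> K) (P : {poly K}) : K :=
  \sum_(i < size P) P`_i * u i.

Section SeqFunctional.

Variables (K : fieldType) (u : nat -> K).

Lemma seq_functional_widen (N : nat) (P : {poly K}) : (size P <= N)%N ->
  seq_functional u P = \sum_(i < N) P`_i * u i.
Proof.
move=> sP; rewrite /seq_functional (big_ord_widen N (fun i => P`_i * u i)) //.
rewrite [RHS](bigID (fun i : 'I_N => (i < size P)%N)) /= [X in _ + X]big1 ?addr0 //.
by move=> i; rewrite -leqNgt => sPi; rewrite nth_default // mul0r.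
Qed.

Lemma seq_functional_linear c (P Q : {poly K}) :
  seq_functional u (c *: P + Q) = c * seq_functional u P + seq_functional u Q.
Proof.
pose N := maxn (size P) (size Q).
have sPQ : (size (c *: P + Q)%R <= N)%N.
  rewrite (leq_trans (size_polyD _ _)) // geq_max leq_maxr andbT.
  by rewrite (leq_trans (size_scale_leq c P)) ?leq_maxl.
rewrite (seq_functional_widen sPQ) (@seq_functional_widen N P) ?leq_maxl //.
rewrite (@seq_functional_widen N Q) ?leq_maxr // mulr_sumr -big_split /=.
by apply: eq_bigr => i _; rewrite coefD coefZ mulrDl mulrA.
Qed.

Lemma seq_functionalXn k : seq_functional u 'X^k = u k.
Proof.
rewrite /seq_functional size_polyXn big_ord_recr /= coefXn eqxx mul1r.
by rewrite big1 ?add0r // => i _; rewrite coefXn ltn_eqF ?mul0r.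
Qed.

Lemma seq_functional_ann (F : {poly K}) :
  (forall k, seq_functional u ('X^k * F) = 0) ->
  forall P, seq_functional u (F * P) = 0.
Proof.
move=> ann P; suff H k : seq_functional u ('X^k * F * P) = 0.
  by have := H 0%N; rewrite mul1r.
elim/poly_ind: P k => [|P c IH] k.
  by rewrite mulr0 /seq_functional size_poly0 big_ord0.
have -> : 'X^k * F * (P * 'X + c%:P) = c *: ('X^k * F) + 'X^(k.+1) * F * P.
  by rewrite -mul_polyC exprS; ring.
by rewrite seq_functional_linear ann IH mulr0 addr0.
Qed.

(** Substituting X^R restricts the functional to the progression i + R j. The restriction is killed
    by G, the product of the X - r^R, because X - r divides X^R - r^R. Then [functional_vanish]
    gives zeros from index t on; as G has no root 0, X^t is invertible modulo G and the first t
    terms vanish too. *)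
Lemma sub_progression_vanish (rs : seq K) (i R M t : nat) :
  M%:R != 0 :> K ->
  (forall r, r \in rs -> r != 0) ->
  {in rs &, forall r s, r ^+ (R * M) = s ^+ (R * M) -> r ^+ R = s ^+ R} ->
  (forall k, seq_functional u ('X^k * \prod_(r <- rs) ('X - r%:P)) = 0) ->
  (forall j, u (i + R * (t + M * j))%N = 0) -> forall j, u (i + R * j)%N = 0.
Proof.
move=> nzM nz inj ann van j.
pose lam P := seq_functional u ('X^i * (P \Po 'X^R)).
have lin c P Q : lam (c *: P + Q) = c * lam P + lam Q.
  by rewrite /lam comp_polyD comp_polyZ mulrDr -scalerAr seq_functional_linear.
have lamX k : lam 'X^k = u (i + R * k)%N.
  by rewrite /lam comp_Xn_poly -exprM -exprD seq_functionalXn.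
pose G : {poly K} := \prod_(r <- [seq r ^+ R | r <- rs]) ('X - r%:P).
have lamG P : lam (G * P) = 0.
  have [Q DQ] : exists Q, G \Po 'X^R = (\prod_(r <- rs) ('X - r%:P)) * Q.
    rewrite /G big_map; elim: (rs) => [|r s [Q IH]].
      by exists 1; rewrite !big_nil mulr1 -polyC1 comp_polyC.
    rewrite !big_cons comp_polyM IH comp_polyB comp_polyX comp_polyC.
    have [H ->] : exists H, 'X^R - (r ^+ R)%:P = H * ('X - r%:P).
      by apply/factor_theorem; rewrite /root !hornerE subrr.
    by exists (H * Q); ring.
  by rewrite /lam comp_polyM DQ mulrCA -mulrA; apply: seq_functional_ann.
have nzR r : r \in [seq r ^+ R | r <- rs] -> r != 0.
  by case/mapP=> s /nz nz_s ->; rewrite expf_neq0.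
have lamXt P : lam ('X^t * P) = 0.
  apply: (@functional_vanish K M _ (fun P => lam ('X^t * P)) nzM _ nzR)
    => [c Q S|x y|Q|k].
  - by rewrite mulrDr -scalerAr lin.
  - case/mapP=> r rrs -> /mapP[s srs ->] /=; rewrite -!exprM; exact: inj.
  - by rewrite mulrCA lamG.
  by rewrite -exprD lamX van.
have /Bezout_eq1_coprimepP[[A B] /= AB] : coprimep 'X^t G.
  apply: coprimep_prod_XsubC => r /nzR nz_r.
  by rewrite /root !hornerE expf_eq0 (negPf nz_r) andbF.
rewrite -lamX -[X in lam X]mul1r -AB.
have -> : (A * 'X^t + B * G) * 'X^j = 1 *: ('X^t * (A * 'X^j)) + G * (B * 'X^j).
  by rewrite scale1r; ring.
by rewrite lin lamXt lamG mulr0 addr0.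
Qed.

End SeqFunctional.

(** * Roots of unity as ratios of conjugates *)

Section LiftingExponent.

Local Open Scope nat_scope.

Lemma expn_add1_2 z x : exists s, (1 + z) ^ x = 1 + x * z + z ^ 2 * s.
Proof.
elim: x => [|x [s IH]]; first by exists 0; rewrite muln0.
by exists (x + s + z * s); rewrite expnS IH; ring.
Qed.

Lemma expn_add1_3 z x :
  exists s, (1 + z) ^ x = 1 + x * z + 'C(x, 2) * z ^ 2 + z ^ 3 * s.
Proof.
elim: x => [|x [s IH]]; first by exists 0; rewrite muln0.
by exists ('C(x, 2) + s + z * s); rewrite expnS IH binS bin1; ring.
Qed.

Lemma dvdn_add_mull p w t : p %| w + p * t = (p %| w).
Proof. by rewrite dvdn_addl // dvdn_mulr. Qed.

(** For odd p the quadratic term of the expansion gains a factor p from ['C(p, 2)], which is what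
    makes a = 1 work; for a >= 2 the square of p^a w is already divisible by p^(a+2). *)
Lemma expn_add1_prime p a w : prime p -> 0 < a -> (2 < p) || (1 < a) ->
  ~~ (p %| w) ->
  exists2 w', ~~ (p %| w') & (1 + p ^ a * w) ^ p = 1 + p ^ a.+1 * w'.
Proof.
move=> p_pr a0 big pw; case/orP: big => [p2|]; last first.
  case: a {a0} => [|[|b]] // _; have [s ->] := expn_add1_2 (p ^ b.+2 * w) p.
  exists (w + p * (p ^ b * w ^ 2 * s)); first by rewrite dvdn_add_mull.
  by rewrite !expnS; ring.
case: a a0 => // b _; have [s ->] := expn_add1_3 (p ^ b.+1 * w) p.
have /dvdnP[c ->] : p %| 'C(p, 2) by rewrite prime_dvd_bin.
exists (w + p * (p ^ b * c * w ^ 2 + (p ^ b) ^ 2 * w ^ 3 * s)).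
  by rewrite dvdn_add_mull.
by rewrite !expnS; ring.
Qed.

Lemma expn_add1_coprime p a w x : prime p -> 0 < a -> ~~ (p %| w) -> ~~ (p %| x) ->
  exists2 w', ~~ (p %| w') & (1 + p ^ a * w) ^ x = 1 + p ^ a * w'.
Proof.
move=> p_pr; case: a => // b _ pw px; have [s ->] := expn_add1_2 (p ^ b.+1 * w) x.
exists (x * w + p * (p ^ b * w ^ 2 * s)).
  by rewrite dvdn_add_mull Euclid_dvdM // negb_or px.
by rewrite !expnS; ring.
Qed.

(** If p^k is the exact power of p in x > 0, then (1 + p^a)^x - 1 has p-adic valuation exactly a +
    k, so e <= a + k. *)
Lemma order_add1_pfactor p a e x : prime p -> 0 < a -> (2 < p) || (1 < a) ->
  (1 + p ^ a) ^ x = 1 %[mod p ^ e] -> p ^ (e - a) %| x.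
Proof.
move=> p_pr a0 big; case: x => [|x'] // E; set x := x'.+1 in E *.
have [y py Dx] := pfactor_coprime p_pr (ltn0Sn x').
have [w pw Dw] : exists2 w, ~~ (p %| w) &
    (1 + p ^ a) ^ (p ^ logn p x) = 1 + p ^ (a + logn p x) * w.
  elim: (logn p x) => [|k [w pw IH]].
    by exists 1; rewrite ?dvdn1 ?addn0 ?muln1 ?expn1 // gtn_eqF // prime_gt1.
  rewrite expnSr expnM IH addnS; apply: (expn_add1_prime p_pr) pw.
    by rewrite addn_gt0 a0.
  by case/orP: big => [->//|a1]; rewrite (leq_trans a1) ?orbT ?leq_addr.
have ak0 : 0 < a + logn p x by rewrite addn_gt0 a0.
have py' : ~~ (p %| y) by rewrite -prime_coprime.
have [w' pw' Dw'] := expn_add1_coprime p_pr ak0 pw py'.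
move/eqP: E; rewrite {1}/x {1}Dx mulnC expnM Dw Dw' eqn_mod_dvd ?leq_addr //.
rewrite addKn mulnC Gauss_dvdr; last by rewrite coprimeXl // prime_coprime.
rewrite dvdn_Pexp2l ?prime_gt1 // => le_e.
by rewrite (dvdn_trans (dvdn_exp2l p _) (pfactor_dvdnn p x)) // leq_subLR.
Qed.

Lemma pfactor_dvd_lcmn p k x y : prime p -> 0 < x -> 0 < y ->
  p ^ k %| lcmn x y -> (p ^ k %| x) || (p ^ k %| y).
Proof.
move=> p_pr x0 y0; rewrite !pfactor_dvdn ?lcmn_gt0 ?x0 //.
by rewrite logn_lcm // leq_max.
Qed.

Lemma exists_Fp_generator p : prime p ->
  exists2 g, coprime g p & forall x, g ^ x = 1 %[mod p] -> p.-1 %| x.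
Proof.
move=> p_pr; have p1 := prime_gt1 p_pr.
have p1_gt0 : 0 < p.-1 by rewrite -ltnS prednK // prime_gt0.
pose rs := enum [set x : 'F_p | x != 0%R].
have /hasP[g _ prim_g] : has (p.-1.-primitive_root)%R rs.
  apply: has_prim_root => //; last 2 first.
  - exact: enum_uniq.
  - have := cardsC1 (0%R : 'F_p); rewrite card_Fp // => <-.
    rewrite -cardE (_ : [set _ | _] = [set~ 0%R]) ?leqnn //.
    by apply/setP => x; rewrite !inE.
  apply/allP => x; rewrite mem_enum inE => nzx; rewrite unity_rootE.
  have : (x ^+ p.-1.+1)%R = x.
    by have := expf_card x; rewrite card_Fp // prednK // prime_gt0.
  rewrite exprSr; move/(canRL (mulfK nzx)); rewrite divff // => ->; exact: eqxx.
exists g => [|x E].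
  rewrite coprime_sym -(unitFpE p_pr) natr_Zp -(unitrX_pos g p1_gt0).
  by rewrite (prim_expr_order prim_g) unitr1.
rewrite (prim_order_dvd prim_g).
have : (g ^ x)%:R = 1%R :> 'F_p.
  by rewrite -(Fp_nat_mod p_pr) E Fp_nat_mod.
by rewrite natrX natr_Zp => ->.
Qed.

(* g^(p^(e-1)) (1 + p) has order (p-1) p^(e-1) modulo p^e, for g of order p-1
   modulo p. *)
Lemma exists_units_generator p e : prime p -> 2 < p -> 0 < e ->
  exists u, [/\ coprime u p, forall x, u ^ x = 1 %[mod p] -> p.-1 %| x &
    forall x, u ^ x = 1 %[mod p ^ e] -> p ^ e.-1 %| x].
Proof.
move=> p_pr p2 e0; have [g co_g ord_g] := exists_Fp_generator p_pr.
have p_gt0 := prime_gt0 p_pr.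
have gpk k : g ^ (p ^ k) = g %[mod p].
  elim: k => [|k IH]; first by rewrite expn1.
  by rewrite expnSr expnM fermat_little.
exists (g ^ (p ^ e.-1) * (1 + p)); split=> [|x|x].
- by rewrite coprimeMl coprimeXl //= add1n coprimeSn.
- have ug : g ^ p ^ e.-1 * (1 + p) = g %[mod p] by rewrite mulnDr muln1 addnC modnMDl.
  by move=> E; apply: ord_g; rewrite -modnXm -ug modnXm.
move=> E; have pe : p ^ e = p ^ e.-1 * p by rewrite -expnSr prednK.
(* Raising to the power p - 1 kills the factor g^(p^(e-1)), and the order of 1 + p remains. *)
suff : p ^ (e - 1) %| p.-1 * x.
  rewrite subn1 Gauss_dvdr // coprimeXl //.
  by rewrite prime_coprime // gtnNdvd //; lia.
apply: order_add1_pfactor => //; rewrite ?p2 // expn1.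
have G1 : (g ^ p ^ e.-1) ^ p.-1 = 1 %[mod p ^ e].
  rewrite -expnM mulnC -totient_pfactor // Euler_exp_totient //.
  by rewrite coprimeXr.
have := congr1 (fun t => t ^ p.-1 %% p ^ e) E; rewrite !modnXm exp1n => <-.
set G := g ^ _ in G1 *.
have -> : ((G * (1 + p)) ^ x) ^ p.-1 = (G ^ p.-1) ^ x * (1 + p) ^ (p.-1 * x).
  by rewrite -expnM [x * _]mulnC expnMn expnM.
have Gx : (G ^ p.-1) ^ x = 1 %[mod p ^ e] by rewrite -modnXm G1 modnXm exp1n.
by rewrite -modnMml Gx modnMml mul1n.
Qed.

End LiftingExponent.

(** * Iterates of an endomorphism of [algC] on [alpha] and [zeta * alpha] *)

Section Orbit.

Variable s : {rmorphism algC -> algC}.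

Lemma iter_rmorphM k x y : iter k s (x * y) = iter k s x * iter k s y.
Proof. by elim: k => //= k ->; rewrite rmorphM. Qed.

Lemma iter_rmorphXn k x l : iter k s (x ^+ l) = iter k s x ^+ l.
Proof. by elim: k => //= k ->; rewrite rmorphXn. Qed.

Lemma iter_rmorph_root_of_unity u z k : s z = z ^+ u -> iter k s z = z ^+ (u ^ k).
Proof.
move=> sz; elim: k => [|k IH] /=; first by rewrite expn0.
by rewrite IH rmorphXn /= sz -exprM expnS.
Qed.

Lemma iter_fix_dvd (T : Type) (f : T -> T) x k l :
  (k %| l)%N -> iter k f x = x -> iter l f x = x.
Proof. by case/dvdnP=> c -> fx; elim: c => //= c IH; rewrite mulSn iterD IH. Qed.

(** [s] permutes the at most n roots of F, so two of the first n + 1 iterates of [alpha] agree;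
    injectivity of [s] cancels the shorter iteration. *)
Lemma iter_fix_root (F : {poly algC}) alpha n :
  F != 0 -> map_poly s F = F -> root F alpha -> (size F <= n.+1)%N ->
  exists2 x, (0 < x <= n)%N & iter x s alpha = alpha.
Proof.
move=> nzF sF rF szF; pose rs := mkseq (fun i => iter i s alpha) n.+1.
have rk k : root F (iter k s alpha).
  by elim: k => //= k IH; rewrite -sF fmorph_root.
have /(uniqPn 0)[i [j [ij]]] : ~~ uniq rs.
  apply/negP => urs; have all_rs : all (root F) rs by apply/allP => _ /mapP[k _ ->].
  by have := leq_trans (max_poly_roots nzF all_rs urs) szF; rewrite size_mkseq ltnn.
rewrite size_mkseq => jn; rewrite !nth_mkseq ?(ltn_trans ij) //.
rewrite -{1}(subnKC (ltnW ij)) iterD => E; exists (j - i)%N; first lia.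
have it_inj : injective (iter i s) by elim: (i) => //= k IH v w /fmorph_inj/IH.
exact/esym/it_inj.
Qed.

Variables (p e u n x y : nat) (alpha zeta : algC).
Hypotheses (p_pr : prime p) (prim : (p ^ e).-primitive_root zeta).
Hypotheses (nz : alpha != 0) (sz : s zeta = zeta ^+ u).
Hypotheses (x_n : (0 < x <= n)%N) (y_n : (0 < y <= n)%N).
Hypotheses (fx : iter x s alpha = alpha) (fy : iter y s (zeta * alpha) = zeta * alpha).

(** The iterate of index [lcmn x y] fixes [alpha] and [zeta * alpha], hence their ratio [zeta]. *)
Lemma orbit_lcm : (u ^ lcmn x y = 1 %[mod p ^ e])%N.
Proof.
have := iter_fix_dvd (dvdn_lcmr x y) fy.
rewrite iter_rmorphM (iter_fix_dvd (dvdn_lcml x y) fx) => /(mulIf nz).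
rewrite (iter_rmorph_root_of_unity _ sz) -[X in _ = X]expr1 => /eqP.
by rewrite (eq_prim_root_expr prim) => /eqP.
Qed.

(* Compare iter x s and iter y s in either order on alpha. *)
Lemma orbit_commutator : (u ^ (x + y) + 1 = u ^ x + u ^ y %[mod p ^ e])%N.
Proof.
apply/eqP; rewrite -(eq_prim_root_expr prim); apply/eqP.
have itz k : iter k s zeta = zeta ^+ (u ^ k) := iter_rmorph_root_of_unity k sz.
move: fy; rewrite iter_rmorphM itz => fy'.
have C : iter x s (iter y s alpha) = iter y s alpha.
  by rewrite -iterD addnC iterD fx.
have := congr1 (iter x s) fy'; rewrite !iter_rmorphM iter_rmorphXn itz fx C.
rewrite -exprM -expnD => E; rewrite exprD expr1.
apply: (mulIf nz); rewrite -mulrA -fy'.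
by rewrite [_ ^+ (_ + _)]exprD mulrCA E mulrCA mulrA.
Qed.

Lemma orbit_bound_ramified a : (0 < a)%N -> (2 < p)%N || (1 < a)%N ->
  u = (1 + p ^ a)%N -> (p ^ (e - a) <= n)%N.
Proof.
case/andP: x_n => x0 xn; case/andP: y_n => y0 yn a0 big Du.
have := orbit_lcm; rewrite Du => /(order_add1_pfactor p_pr a0 big).
case/(pfactor_dvd_lcmn p_pr x0 y0)/orP => /dvdn_leq le_pe.
  by apply: leq_trans xn; apply: le_pe.
by apply: leq_trans yn; apply: le_pe.
Qed.

Lemma orbit_bound_unramified : (2 < p)%N -> (0 < e)%N -> coprime u p ->
  (forall k, u ^ k = 1 %[mod p] -> p.-1 %| k)%N ->
  (forall k, u ^ k = 1 %[mod p ^ e] -> p ^ e.-1 %| k)%N ->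
  (p ^ e.-1 * p.-1 <= n)%N.
Proof.
case/andP: x_n => x0 xn; case/andP: y_n => y0 yn p2 e0 co ord1 ord2.
have u0 : (0 < u)%N.
  by case: (u) co => //; rewrite /coprime gcd0n => /eqP p1; rewrite p1 in p2.
have ordM k : (0 < k <= n)%N -> (p.-1 %| k)%N -> (p ^ e.-1 %| k)%N ->
    (p ^ e.-1 * p.-1 <= n)%N.
  case/andP=> k0 kn d1 d2; apply: leq_trans kn; apply: dvdn_leq => //.
  by rewrite Gauss_dvd ?d1 ?d2 // coprimeXl // coprimenP // prime_gt0.
have dvd_pe k : (p ^ e %| k)%N -> (p %| k)%N.
  by apply: dvdn_trans; rewrite -{1}(expn1 p) dvdn_exp2l.
(* The congruence of [orbit_commutator] in factored form. If p misses one factor, p^e divides the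
   other. *)
have comm : (p ^ e %| (u ^ x - 1) * (u ^ y - 1))%N.
  have /eqP := orbit_commutator; rewrite eqn_mod_dvd => [|]; rewrite expnD.
    have ux : (0 < u ^ x)%N by rewrite expn_gt0 u0.
    have uy : (0 < u ^ y)%N by rewrite expn_gt0 u0.
    rewrite -{1 2}(prednK ux) -{1 2}(prednK uy) -!subn1.
    congr (_ %| _)%N; nia.
  have ux : (0 < u ^ x)%N by rewrite expn_gt0 u0.
  have uy : (0 < u ^ y)%N by rewrite expn_gt0 u0.
  nia.
have E1 k q : (u ^ k = 1 %[mod q] <-> q %| u ^ k - 1)%N.
  rewrite -eqn_mod_dvd ?expn_gt0 ?u0 //; split=> [->//|/eqP//].
have [dx|ndx] := boolP (p %| u ^ x - 1)%N; last first.
  have dy : (p ^ e %| u ^ y - 1)%N.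
    by move: comm; rewrite Gauss_dvdr // coprimeXl // prime_coprime.
  by apply: (ordM y) => //; [apply/ord1/E1/dvd_pe | apply/ord2/E1].
have [dy|ndy] := boolP (p %| u ^ y - 1)%N; last first.
  have {}dx : (p ^ e %| u ^ x - 1)%N.
    by move: comm; rewrite Gauss_dvdl // coprimeXl // prime_coprime.
  by apply: (ordM x) => //; [apply/ord1/E1/dvd_pe | apply/ord2/E1].
(* Here p - 1 divides both x and y, so it is enough that p^(e-1) divides one of them. *)
have := ord2 _ orbit_lcm => /(pfactor_dvd_lcmn p_pr x0 y0)/orP[] d.
  by apply: (ordM x) => //; apply/ord1/E1.
by apply: (ordM y) => //; apply/ord1/E1.
Qed.

End Orbit.

(** Chinese remaindering gives an exponent k equal to u modulo p^e and to 1 modulo the prime-to-p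
    part m' of m. Raising the roots of unity of order dividing p^e m' to the power k extends to
    [algC]; as u = 1 modulo the p-part of m, also k = 1 modulo m. *)
Lemma exists_aut_pfactor (m p e u : nat) :
  prime p -> (0 < m)%N -> (logn p m <= e)%N -> coprime u p ->
  (u = 1 %[mod p ^ logn p m])%N ->
  exists2 s : {rmorphism algC -> algC}, forall z, z ^+ m = 1 -> s z = z &
    forall z, z ^+ (p ^ e) = 1 -> s z = z ^+ u.
Proof.
move=> p_pr m0 le_e co u1; have [m' pm' Dm] := pfactor_coprime p_pr m0.
have co' : coprime (p ^ e) m' by rewrite coprimeXl.
pose k := chinese (p ^ e) m' u 1.
have k_u : (k = u %[mod p ^ e])%N := chinese_modl co' u 1.
have k_1 : (k = 1 %[mod m'])%N := chinese_modr co' u 1.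
have [|s Hs] := @Qn_aut_exists k (p ^ e * m').
  by rewrite coprimeMr -coprime_modl k_u coprime_modl coprimeXr // -coprime_modl
    k_1 coprime_modl coprime1n.
exists s => z z1.
  rewrite Hs; last first.
    rewrite -(subnK le_e) expnD -mulnA [(p ^ logn p m * _)%N]mulnC -Dm.
    by rewrite mulnC exprM z1 expr1n.
  have /eqP k1 : k == 1 %[mod m].
    rewrite Dm chinese_remainder; last by rewrite coprime_sym coprimeXl.
    rewrite k_1 eqxx /=.
    have dvd := dvdn_exp2l p le_e.
    by rewrite -(modn_dvdm k dvd) k_u (modn_dvdm _ dvd) u1.
  by rewrite -(expr_mod k z1) k1 (expr_mod _ z1) expr1.
rewrite Hs; last by rewrite exprM z1 expr1n.
by rewrite -(expr_mod k z1) k_u (expr_mod _ z1).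
Qed.

(* Holds when alpha is a root of a nonzero polynomial of degree n over Q(mu_m);
   stated without fixing an embedding of the abstract field into algC. *)
Definition small_orbits (m n : nat) (alpha : algC) : Prop :=
  forall s : {rmorphism algC -> algC}, (forall z, z ^+ m = 1 -> s z = z) ->
  exists2 x, (0 < x <= n)%N & iter x s alpha = alpha.

Lemma small_orbitsX m n alpha k : small_orbits m n alpha -> small_orbits m n (alpha ^+ k).
Proof.
by move=> H s /H[x xn fx]; exists x => //; rewrite iter_rmorphXn fx.
Qed.

Section TorsionRatio.

Variables (m n p e : nat) (alpha zeta : algC).
Hypotheses (m_gt0 : (0 < m)%N) (p_pr : prime p).
Hypotheses (prim : (p ^ e).-primitive_root zeta) (nz : alpha != 0).
Hypotheses (so_a : small_orbits m n alpha) (so_b : small_orbits m n (zeta * alpha)).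

Lemma torsion_unramified : ~~ (p %| m)%N -> (2 < p)%N -> (0 < e)%N ->
  (p ^ e.-1 * p.-1 <= n)%N.
Proof.
move=> pm p2 e0; have [u [co ord1 ord2]] := exists_units_generator p_pr p2 e0.
have lpm : logn p m = 0%N by rewrite logn_coprime // prime_coprime.
have [||s fix_m sz] := @exists_aut_pfactor m p e u p_pr m_gt0 _ co.
- by rewrite lpm.
- by rewrite lpm !modn1.
have [x xn fx] := so_a fix_m; have [y yn fy] := so_b fix_m.
exact: (orbit_bound_unramified p_pr prim nz (sz _ (prim_expr_order prim)) xn yn fx fy).
Qed.

Lemma torsion_ramified a : (0 < a)%N -> (2 < p)%N || (1 < a)%N ->
  (logn p m <= a)%N -> (a <= e)%N -> (p ^ (e - a) <= n)%N.
Proof.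
move=> a0 big le_a le_e.
have co : coprime (1 + p ^ a) p.
  rewrite coprime_sym prime_coprime // dvdn_addl ?dvdn_exp // dvdn1.
  by rewrite gtn_eqF // prime_gt1.
have [||s fix_m sz] := @exists_aut_pfactor m p e (1 + p ^ a) p_pr m_gt0 _ co.
- exact: leq_trans le_a le_e.
- by rewrite -(subnK le_a) expnD addnC modnMDl.
have [x xn fx] := so_a fix_m; have [y yn fy] := so_b fix_m.
exact: (orbit_bound_ramified p_pr prim nz (sz _ (prim_expr_order prim)) xn yn fx fy).
Qed.

End TorsionRatio.

(** The bounds are matched with the exponents case by case. The last hypothesis is separate because
    for p = 2 and ord_2(m) = 1 the previous one only allows a >= 2, hence e <= 2 when n = 1, whereas
    [R_even m 1] is [m] and calls for e <= 1. *)
Lemma pfactor_dvd_R_even (m n p e : nat) :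
  prime p -> (0 < m)%N -> (0 < n)%N -> (2 %| m)%N -> (0 < e)%N ->
  (~~ (p %| m) -> p ^ e.-1 * p.-1 <= n)%N ->
  (forall a, 0 < a -> (2 < p) || (1 < a) -> logn p m <= a -> a <= e ->
    p ^ (e - a) <= n)%N ->
  (n = 1 -> p = 2 -> logn p m = 1 -> e <= 1)%N ->
  (p ^ e %| R_even m n)%N.
Proof.
move=> p_pr m0 n0 m2 e0 unram ram two; have p1 := prime_gt1 p_pr; have p0 := ltnW p1.
have lg0 : (p %| m -> 0 < logn p m)%N by rewrite -pfactor_dvdn // expn1.
have p2 : (~~ (p %| m) -> 2 < p)%N.
  by move=> npm; rewrite ltn_neqAle p1 andbT; apply: contraNneq npm => <-.
rewrite /R_even; case: eqP => [n1|n1].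
  rewrite pfactor_dvdn //; have [pm|npm] := boolP (p %| m)%N; last first.
    have := unram npm; have := p2 npm; have := expn_gt0 p e.-1; rewrite p0 n1 /=.
    by move: (p ^ _)%N => q; nia.
  have [//|lt] := leqP e (logn p m).
  have [big|] := boolP ((2 < p) || (1 < logn p m))%N.
    have := ram _ (lg0 pm) big (leqnn _) (ltnW lt); rewrite n1.
    by rewrite leqNgt -(expn0 p) ltn_exp2l // subn_gt0 lt.
  rewrite negb_or -leqNgt => /andP[le_p2 le_l1].
  have Dp : p = 2%N by apply/anti_leq; rewrite le_p2.
  have l1 : logn p m = 1%N by apply/anti_leq; rewrite leqNgt le_l1 lg0.
  by have := leq_trans lt (leq_trans (two n1 Dp l1) (lg0 pm)); rewrite ltnn.
have p_le : (p < m + n + 2)%N.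
  have [pm|npm] := boolP (p %| m)%N; first by have := dvdn_leq m0 pm; lia.
  have := unram npm; have := expn_gt0 p e.-1; rewrite p0 /=; move: (p ^ _)%N => q; nia.
have : (p ^ R_exponent m n p %|
    \prod_(0 <= q < m + n + 2 | prime q) q ^ R_exponent m n q)%N.
  by rewrite big_mkcond (big_rem p) ?mem_index_iota //= p_pr dvdn_mulr.
apply: dvdn_trans; apply: dvdn_exp2l; rewrite /R_exponent.
have [pm|npm] := boolP (p %| m)%N => /=; last first.
  have le_n := unram npm.
  have pn : (p.-1 <= n)%N by apply: leq_trans le_n; rewrite leq_pmull // expn_gt0 p0.
  rewrite ifF; last by lia.
  rewrite (p2 npm) ifT; last by lia.
  rewrite -leq_subLR floor_log_quotP // subn1 ?subn1 //.
  by rewrite -subn1 subn_gt0 p1 subn1.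
case: ifP => [/andP[/eqP Dp /eqP l1]|nl1].
  have [e2|e2] := leqP e 2; first by rewrite (leq_trans e2) // leq_addr.
  rewrite -leq_subLR; apply: trunc_log_max => //.
  by move: ram; rewrite Dp => ram; apply: ram; rewrite ?l1 // ltnW.
have big : ((2 < p) || (1 < logn p m))%N.
  apply/negPn/negP; rewrite negb_or -!leqNgt => /andP[le_p2 le_l1].
  have Dp : p = 2%N by apply/anti_leq; rewrite le_p2.
  have := lg0 pm; move: le_l1 nl1; rewrite Dp eqxx /=.
  by case: (logn 2 m) => [|[]].
rewrite ifT; last first.
  have [p_gt2|] := ltnP 2 p.
    by rewrite Gauss_dvd ?m2 // coprime_sym prime_coprime // gtnNdvd.
  move=> le_p2; have Dp : p = 2%N by apply/anti_leq; rewrite le_p2.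
  by move: big; rewrite Dp /= => l2; rewrite (_ : (2 * 2 = 2 ^ 2)%N) // pfactor_dvdn.
have [le|lt] := leqP e (logn p m); first by rewrite (leq_trans le) // leq_addr.
by rewrite -leq_subLR trunc_log_max // ram // ?lg0 // ltnW.
Qed.

(** The order d of beta / alpha is treated one prime at a time: raising to the power d / p^e leaves
    a ratio of order exactly p^e and preserves [small_orbits]. *)
Lemma torsion_ratio_R_even (m n M : nat) (alpha beta : algC) :
  (0 < m)%N -> (0 < n)%N -> (2 %| m)%N -> (0 < M)%N ->
  alpha != 0 -> small_orbits m n alpha -> small_orbits m n beta ->
  alpha ^+ M = beta ^+ M -> alpha ^+ R_even m n = beta ^+ R_even m n.
Proof.
move=> m0 n0 m2 M0 nz soa sob eqM; pose zeta := beta / alpha.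
have Db : beta = zeta * alpha by rewrite divfK.
suff zR : zeta ^+ R_even m n = 1 by rewrite Db exprMn zR mul1r.
have zM : zeta ^+ M = 1 by rewrite exprMn exprVn -eqM divff ?expf_neq0.
have [d prim_d _] := prim_order_exists M0 zM; apply/eqP.
rewrite -(prim_order_dvd prim_d); have d0 := prim_order_gt0 prim_d.
apply/dvdn_partP => // p; rewrite mem_primes d0 /= => /andP[p_pr pd].
rewrite p_part; set e := logn p d.
have e0 : (0 < e)%N by rewrite -pfactor_dvdn // expn1.
have dvd_e : (p ^ e %| d)%N := pfactor_dvdnn p d.
pose k := (d %/ p ^ e)%N; have Dd : (d = k * p ^ e)%N by rewrite divnK.
have k0 : (0 < k)%N by move: d0; rewrite Dd; case: (k).
have prim : (p ^ e).-primitive_root (zeta ^+ k).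
  have := exp_prim_root prim_d k; rewrite {2}Dd gcdnMr {1}Dd mulKn //.
have nzk : alpha ^+ k != 0 by rewrite expf_neq0.
have soak := small_orbitsX k soa.
have sobk : small_orbits m n (zeta ^+ k * alpha ^+ k).
  by rewrite -exprMn -Db; apply: small_orbitsX.
apply: pfactor_dvd_R_even => //.
- move=> npm; have p2 : (2 < p)%N.
    by rewrite ltn_neqAle (prime_gt1 p_pr) andbT; apply: contraNneq npm => <-.
  exact: (torsion_unramified m0 p_pr prim nzk soak sobk).
- by move=> a; apply: (torsion_ramified m0 p_pr prim nzk soak sobk).
(* With n = 1 the automorphism itself fixes both numbers; the exponent 3 is 1 modulo 2 but not
   modulo 4. *)
move=> n1 p2 l1; rewrite leqNgt; apply/negP => e1.
have [|||s fix_m sz] := @exists_aut_pfactor m p e 3 p_pr m0.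
- by rewrite l1 ltnW.
- by rewrite p2.
- by rewrite l1 p2.
have [[|[|x]] xn fx] := soak s fix_m; try by move: xn; rewrite n1.
have [[|[|y]] yn fy] := sobk s fix_m; try by move: yn; rewrite n1.
have := orbit_lcm prim nzk (sz _ (prim_expr_order prim)) fx fy.
move/eqP; rewrite eqn_mod_dvd // p2 => /dvdn_leq-/(_ isT).
by rewrite leqNgt (@ltn_exp2l 2 1) // e1.
Qed.

(** * Cyclotomic fields *)

(** z is sent to a complex root w of its minimal polynomial. An element is written as a polynomial
    in z by choice; the value at w does not depend on that choice. *)
Lemma number_field_embedding (L : fieldExtType rat) (z : L) :
  <<1; z>>%VS = fullv -> inhabited {rmorphism L -> algC}.
Proof.
move=> gen_z; pose inL q := map_poly (in_alg L) q.
pose inC q := map_poly (ratr : rat -> algC) q.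
have [r Dr] : exists r, minPoly 1 z = inL r by apply/polyOver1P/minPolyOver.
have [w rw] : exists w, root (inC r) w.
  apply/closed_rootP; rewrite size_map_poly -(size_map_poly (in_alg L)) -/(inL r) -Dr.
  by rewrite size_minPoly.
have well_def q1 q2 : (inL q1).[z] = (inL q2).[z] -> (inC q1).[w] = (inC q2).[w].
  move=> E; apply/eqP; rewrite -subr_eq0 -hornerN -hornerD -rmorphB /=.
  have : minPoly 1 z %| inL (q1 - q2).
    apply: minPoly_dvdp; first by apply/polyOver1P; exists (q1 - q2).
    by rewrite /root /inL rmorphB hornerD hornerN -/(inL _) E subrr.
  by rewrite Dr dvdp_map => /dvdpP[q ->]; rewrite rmorphM hornerM /= (eqP rw) mulr0.
have ex_q (x : L) : exists q, (inL q).[z] == x.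
  have /Fadjoin_polyP[p /polyOver1P[q ->] ->] : x \in <<1; z>>%VS by rewrite gen_z memvf.
  by exists q.
pose pol x := xchoose (ex_q x); pose f x := (inC (pol x)).[w].
have polE x : (inL (pol x)).[z] = x by apply/eqP/(xchooseP (ex_q x)).
have fE q : f (inL q).[z] = (inC q).[w] by apply: well_def; rewrite polE.
have f_zmod : zmod_morphism f.
  move=> x y; rewrite -{1}[x]polE -{1}[y]polE -hornerN -hornerD -rmorphB fE.
  by rewrite /inC rmorphB hornerD hornerN.
have f_monoid : monoid_morphism f.
  split=> [|x y]; last first.
    by rewrite -{1}[x]polE -{1}[y]polE -hornerM -rmorphM fE /inC rmorphM hornerM.
  have inL1 : (inL 1).[z] = 1 by rewrite /inL rmorph1 hornerC.
  by rewrite -{1}inL1 fE /inC rmorph1 hornerC.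
pose zmix := GRing.isZmodMorphism.Build L algC f f_zmod.
pose mmix := GRing.isMonoidMorphism.Build L algC f f_monoid.
by exists; exact: (HB.pack f zmix mmix).
Qed.

Lemma separable_Xn_sub_1_number_field (L : fieldExtType rat) (m : nat) :
  (0 < m)%N -> separable_poly ('X^m - 1 : {poly L}).
Proof.
move=> m0; rewrite separable_Xn_sub_1 // -(rmorph_nat (in_alg L)) fmorph_eq0.
by rewrite pnatr_eq0 -lt0n.
Qed.

Lemma cyclotomic_generator (m : nat) (L : fieldExtType rat) :
  (0 < m)%N -> is_cyclotomic_field m L ->
  exists2 z : L, z ^+ m = 1 & <<1; z>>%VS = fullv.
Proof.
move=> m0 [rs Drs gen_rs].
have mem_rs x : (x \in rs) = (x ^+ m == 1).
  by rewrite -root_prod_XsubC -(eqp_root Drs) /root !hornerE subr_eq0.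
have sep : separable_poly (\prod_(x <- rs) ('X - x%:P)).
  by rewrite -(eqp_separable Drs) separable_Xn_sub_1_number_field.
have /hasP[z _ prim] : has m.-primitive_root rs.
  apply: has_prim_root => //.
  - by apply/allP => x; rewrite mem_rs unity_rootE.
  - by rewrite -separable_prod_XsubC.
  by have := eqp_size Drs; rewrite size_prod_XsubC size_XnsubC // => -[->].
exists z; first exact: prim_expr_order.
apply/eqP; rewrite eqEsubv subvf -gen_rs; apply/Fadjoin_seqP; split.
  exact: subv_adjoin.
move=> x; rewrite mem_rs => /eqP/(prim_rootP prim)[i ->].
by rewrite rpredX // memv_adjoin.
Qed.

(** By the Galois correspondence, the field generated by x is the fixed field of the automorphisms
    that fix x. The index type is finite so that bounds can later be taken uniformly over it. *)
Lemma cyclotomic_galois (m : nat) (L : fieldExtType rat) :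
  (0 < m)%N -> is_cyclotomic_field m L ->
  exists (G : finType) (phi : G -> {rmorphism L -> L}), forall x y : L,
    (forall g, phi g x = x -> phi g y = y) -> (gen_field y <= gen_field x)%VS.
Proof.
move=> m0 cycL.
have split_ax : splitting_field_axiom L.
  by exists ('X^m - 1) => //; rewrite rpredB ?rpred1 ?rpredX ?polyOverX.
pose L' : splittingFieldType rat :=
  HB.pack L (FieldExt_isSplittingField.Build rat L split_ax).
exists (gal_of {:L'}), (fun g => gal_repr g : {rmorphism L' -> L'}) => x y fixy.
apply/FadjoinP; split; first exact: sub1v.
have galL : galois (<<1; (x : L')>>%AS) {:L'}%AS.
  apply: galoisS (_ : galois 1%AS _); first by rewrite sub1v subvf.
  apply/splitting_galoisField; exists ('X^m - 1); split=> //.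
    by rewrite rpredB ?rpred1 ?rpredX ?polyOverX.
  exact: separable_Xn_sub_1_number_field.
suff : (y : L') \in fixedField 'Gal({:L'} / <<1; (x : L')>>)%g.
  by rewrite (galois_fixedField galL).
apply/fixedFieldP; first exact: memvf.
move=> g gal_g; apply: fixy; apply: (fixed_gal _ gal_g); first exact: subvf.
exact: memv_adjoin.
Qed.

(** * Zeros along progressions modulo R *)

Definition rec_poly (K : fieldType) (n : nat) (c : nat -> K) : {poly K} :=
  'X^n - \sum_(1 <= i < n.+1) c i *: 'X^(n - i).

Section RecurrencePolynomial.

Variables (K : fieldType) (n : nat) (c : nat -> K).
Hypothesis n_gt0 : (0 < n)%N.

Lemma size_rec_poly : size (rec_poly n c) = n.+1.
Proof.
rewrite /rec_poly size_polyDl size_polyXn // size_polyN ltnS.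
rewrite big_nat; apply: (leq_trans (size_sum _ _ _)).
apply/bigmax_leqP_seq => i _ /andP[i0 i_n].
rewrite (leq_trans (size_scale_leq _ _)) // size_polyXn.
by rewrite ltn_subrL i0.
Qed.

Lemma monic_rec_poly : rec_poly n c \is monic.
Proof.
rewrite monicE lead_coefE size_rec_poly /= coefB coefXn eqxx coef_sum big1_seq ?subr0 //.
move=> i; rewrite mem_index_iota => /andP[_ /andP[i0 i_n]].
by rewrite coefZ coefXn gtn_eqF ?mulr0 // ltn_subrL i0 n_gt0.
Qed.

Lemma rec_poly_0 : (rec_poly n c).[0] = - c n.
Proof.
rewrite /rec_poly hornerD hornerN hornerXn expr0n gtn_eqF // add0r horner_sum.
rewrite big_nat_recr //= subnn hornerZ hornerXn expr0 mulr1 big1_seq ?add0r //.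
move=> i; rewrite mem_index_iota => /andP[_ /andP[i0 i_n]].
by rewrite hornerZ hornerXn expr0n subn_eq0 leqNgt i_n mulr0.
Qed.

Lemma rec_poly_ann (b : nat -> K) :
  (forall k, (n <= k)%N -> b k = \sum_(1 <= i < n.+1) c i * b (k - i)%N) ->
  forall k, seq_functional b ('X^k * rec_poly n c) = 0.
Proof.
move=> rec k.
have sumE (r : seq nat) : seq_functional b (\sum_(i <- r) c i *: 'X^(k + (n - i)))
    = \sum_(i <- r) c i * b (k + (n - i))%N.
  elim: r => [|i r IH].
    by rewrite !big_nil /seq_functional size_poly0 big_ord0.
  by rewrite !big_cons seq_functional_linear IH seq_functionalXn.
have -> : 'X^k * rec_poly n c =
    (-1) *: \sum_(1 <= i < n.+1) c i *: 'X^(k + (n - i)) + 'X^(k + n).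
  rewrite /rec_poly mulrBr -exprD scaleN1r addrC mulr_sumr; congr (- _ + _).
  by apply: eq_bigr => i _; rewrite -scalerAr -exprD.
rewrite seq_functional_linear sumE seq_functionalXn rec ?leq_addl // mulN1r addrC.
apply/eqP; rewrite subr_eq0; apply/eqP.
rewrite !big_nat; apply: eq_bigr => i /andP[i0 i_n].
by rewrite addnBA.
Qed.

End RecurrencePolynomial.

Lemma map_rec_poly (K K' : fieldType) (f : {rmorphism K -> K'}) n (c : nat -> K) :
  map_poly f (rec_poly n c) = rec_poly n (fun i => f (c i)).
Proof.
rewrite /rec_poly rmorphB /= map_polyXn rmorph_sum; congr (_ - _).
by apply: eq_bigr => i _; rewrite /= map_polyZ map_polyXn.
Qed.

(** The constant term is [- c n], so 0 is not a root; an automorphism fixing the m-th roots of unity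
    fixes the coefficients, so [iter_fix_root] applies in degree n. *)
Lemma rec_poly_roots (m n : nat) (c : nat -> algC) :
  (0 < n)%N -> c n != 0 ->
  (forall s : {rmorphism algC -> algC}, (forall z, z ^+ m = 1 -> s z = z) ->
    forall i, s (c i) = c i) ->
  exists rs, [/\ rec_poly n c = \prod_(r <- rs) ('X - r%:P),
    forall r, r \in rs -> r != 0 & forall r, r \in rs -> small_orbits m n r].
Proof.
move=> n0 nz_c fix_c; have [rs Drs] := closed_field_poly_normal (rec_poly n c).
have mon := monic_rec_poly c n0; rewrite (monicP mon) scale1r in Drs.
have rootE r : (r \in rs) = root (rec_poly n c) r by rewrite Drs root_prod_XsubC.
exists rs; split=> // r; rewrite rootE => root_r.
  apply: contraTneq root_r => ->.
  by rewrite /root (rec_poly_0 c n0) oppr_eq0.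
move=> s fix_m; apply: (iter_fix_root (monic_neq0 mon)) root_r _; last first.
  by rewrite size_rec_poly.
rewrite map_rec_poly /rec_poly; congr (_ - _).
by apply: eq_bigr => i _; rewrite fix_c.
Qed.

(** Either some tail of a class modulo M lies in P, which then spreads to everything, or each of the
    M residue classes meets P in a bounded set. *)
Lemma fin_or_all_residues (P : nat -> Prop) (M : nat) : (0 < M)%N ->
  (forall t, fin_or_all (fun j => P (t + M * j)%N)) ->
  (forall t, (forall j, P (t + M * j)%N) -> forall j, P j) ->
  fin_or_all P.
Proof.
move=> M0 Pt allP.
case: (classic (exists t, forall j, P (t + M * j)%N)) => [[t Ht]|noall].
  by left; apply: allP Ht.
right; pose bounds (t : 'I_M) (B : nat) := forall j, P (t + M * j)%N -> (j <= B)%N.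
have [B HB] : exists B, forall t, bounds t (B t).
  by apply: fin_all_exists => t; case: (Pt t) => // all_t; case: noall; exists t.
exists (M * (\sum_t B t).+1)%N => j Pj.
pose t := Ordinal (ltn_pmod j M0).
have : (j %/ M <= B t)%N by apply: HB; rewrite /= mulnC addnC -divn_eq.
rewrite -ltnS => /leq_trans le_q; have {le_q} : (j %/ M < (\sum_t B t).+1)%N.
  by apply: le_q; rewrite ltnS (bigD1 t) //= leq_addr.
by rewrite ltn_divLR // mulnC => /ltnW.
Qed.

Section Dichotomy.

Variables (m n : nat) (L : fieldExtType rat) (z : L) (a c : nat -> L).
Hypotheses (m_gt0 : (0 < m)%N) (m_even : (2 %| m)%N) (n_gt0 : (0 < n)%N).
Hypotheses (zm : z ^+ m = 1) (gen_z : <<1; z>>%VS = fullv) (nz_c : c n != 0).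
Hypothesis rec : forall k, (n <= k)%N -> a k = \sum_(1 <= i < n.+1) c i * a (k - i)%N.

Let R := R_even m n.

Lemma aut_fix_number_field (iota : {rmorphism L -> algC})
    (s : {rmorphism algC -> algC}) :
  (forall y, y ^+ m = 1 -> s y = y) -> forall x, s (iota x) = iota x.
Proof.
move=> fix_m x.
have /Fadjoin_polyP[p /polyOver1P[q ->] ->] : x \in <<1; z>>%VS by rewrite gen_z memvf.
rewrite -!horner_map /= fix_m; last by rewrite -rmorphXn zm rmorph1.
congr (_.[_]); rewrite -!map_poly_comp; apply: eq_map_poly => y /=.
by rewrite alg_num_field !fmorph_rat.
Qed.

Lemma R_even_gt0 : (0 < R)%N.
Proof.
rewrite /R /R_even; case: eqP => // _; rewrite prodn_cond_gt0 // => p p_pr.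
by rewrite expn_gt0 prime_gt0.
Qed.

(** The annihilator of degree 2n is kept as a product of two polynomials of degree n: each root then
    has an orbit of length at most n, which is why [R] depends on n rather than 2n. *)
Lemma dichotomy_of_annihilator (iota : {rmorphism L -> algC}) (c2 : nat -> algC)
    (h : 'End(L)) :
  c2 n != 0 ->
  (forall s : {rmorphism algC -> algC}, (forall y, y ^+ m = 1 -> s y = y) ->
    forall i, s (c2 i) = c2 i) ->
  (forall k, seq_functional (fun k => iota (h (a k)))
    ('X^k * (rec_poly n (fun i => iota (c i)) * rec_poly n c2)) = 0) ->
  forall i, fin_or_all (fun j => h (a (i + R * j)%N) = 0).
Proof.
move=> nz_c2 fix_c2 ann i; have R0 := R_even_gt0.
have [|s|rs1 [D1 nz1 so1]] := @rec_poly_roots m n (fun i => iota (c i)) n_gt0.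
- by rewrite fmorph_eq0.
- by move=> fix_m k; apply: aut_fix_number_field.
have [rs2 [D2 nz2 so2]] := rec_poly_roots n_gt0 nz_c2 fix_c2.
have [|M M0 HM] := @linear_recurrence_skolem L n a n_gt0; first by exists c.
have nz r : r \in rs1 ++ rs2 -> r != 0.
  by rewrite mem_cat => /orP[/nz1|/nz2].
have so r : r \in rs1 ++ rs2 -> small_orbits m n r.
  by rewrite mem_cat => /orP[/so1|/so2].
apply: (fin_or_all_residues M0) => [t|t vt j].
  have [all0|[B HB]] := HM h (i + R * t)%N.
    by left=> j; rewrite mulnDr addnA mulnCA; apply: all0.
  right; exists B => j; rewrite mulnDr addnA mulnCA => /HB le_j.
  by apply: leq_trans le_j; rewrite leq_pmull.
apply: (fmorph_inj iota); rewrite rmorph0; move: j.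
apply: (@sub_progression_vanish _ (fun k => iota (h (a k))) (rs1 ++ rs2) i R M t) => //.
- by rewrite pnatr_eq0 -lt0n.
- move=> r s r_rs s_rs; apply: torsion_ratio_R_even => //; first by rewrite muln_gt0 R0.
  + exact: nz.
  + exact: so.
  exact: so.
- by move=> k; rewrite big_cat -D1 -D2; apply: ann.
by move=> j; rewrite vt rmorph0.
Qed.

Lemma zero_dichotomy i : fin_or_all (fun j => a (i + R * j)%N = 0).
Proof.
have [iota] := number_field_embedding gen_z.
have fixc (s : {rmorphism algC -> algC}) : (forall y, y ^+ m = 1 -> s y = y) ->
    forall i, s (iota (c i)) = iota (c i).
  by move=> fix_m k; apply: aut_fix_number_field.
have nzc : iota (c n) != 0 by rewrite fmorph_eq0.
(* The identity fits the two-factor form with the same polynomial twice, since multiples of an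
   annihilator annihilate. *)
have := @dichotomy_of_annihilator iota (fun i => iota (c i)) \1%VF nzc fixc.
move=> H; apply: fin_or_all_iff (H _ i) => [j|k]; first by rewrite id_lfunE.
have ann : forall k, seq_functional (fun k => iota (\1%VF (a k)))
    ('X^k * rec_poly n (fun i => iota (c i))) = 0.
  apply: rec_poly_ann => // l le_l; rewrite id_lfunE rec // rmorph_sum.
  by apply: eq_bigr => j _; rewrite id_lfunE rmorphM.
by rewrite mulrCA; apply: seq_functional_ann.
Qed.

Lemma fix_dichotomy (phi : {rmorphism L -> L}) i :
  fin_or_all (fun j => phi (a (i + R * j)%N) = a (i + R * j)%N).
Proof.
have [iota] := number_field_embedding gen_z.
have lin : linear phi by move=> b x y; rewrite rmorphD fmorph_numZ.
pose lphi : {linear L -> L} := HB.pack (phi : L -> L)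
  (GRing.isLinear.Build rat L L *:%R phi lin).
pose h : 'End(L) := (linfun lphi - \1)%VF.
have hE x : h x = phi x - x by rewrite /h add_lfunE opp_lfunE id_lfunE lfunE.
have fixc (s : {rmorphism algC -> algC}) : (forall y, y ^+ m = 1 -> s y = y) ->
    forall i, s (iota (phi (c i))) = iota (phi (c i)).
  by move=> fix_m k; apply: aut_fix_number_field.
have nzc : iota (phi (c n)) != 0 by rewrite !fmorph_eq0.
apply: fin_or_all_iff (dichotomy_of_annihilator (h := h) nzc fixc _ i) => [j|k].
  by rewrite hE; split=> [/subr0_eq|->]; rewrite ?subrr.
pose F1 := rec_poly n (fun i => iota (c i)).
pose F2 := rec_poly n (fun i => iota (phi (c i))).
have ann1 P : seq_functional (fun k => iota (a k)) (F1 * P) = 0.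
  apply: seq_functional_ann; apply: rec_poly_ann => // l le_l.
  by rewrite rec // rmorph_sum; apply: eq_bigr => j _; rewrite rmorphM.
have ann2 P : seq_functional (fun k => iota (phi (a k))) (F2 * P) = 0.
  apply: seq_functional_ann; apply: rec_poly_ann => // l le_l.
  by rewrite rec // !rmorph_sum; apply: eq_bigr => j _; rewrite !rmorphM.
(* The conjugate sequence is killed by F2 and the original one by F1, so their difference is killed
   by F1 F2. *)
transitivity (seq_functional (fun k => iota (phi (a k))) (F2 * ('X^k * F1))
    - seq_functional (fun k => iota (a k)) (F1 * ('X^k * F2))); last first.
  by rewrite ann1 ann2 subr0.
have -> : F2 * ('X^k * F1) = 'X^k * (F1 * F2) by ring.
have -> : F1 * ('X^k * F2) = 'X^k * (F1 * F2) by ring.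
rewrite /seq_functional -sumrB; apply: eq_bigr => l _.
by rewrite hE rmorphB mulrBr.
Qed.

End Dichotomy.

(** * Virtual periods *)

Lemma uniform_bound (I : finType) (P : I -> nat -> Prop) :
  (forall i, fin_or_all (P i)) ->
  exists B, forall i, (forall j, P i j) \/ (forall j, P i j -> (j <= B)%N).
Proof.
move=> HP.
have [B HB] : exists B : I -> nat, forall i,
    (forall j, P i j) \/ (forall j, P i j -> (j <= B i)%N).
  apply: (@fin_all_exists _ _
    (fun i (b : nat) => (forall j, P i j) \/ (forall j, P i j -> (j <= b)%N))) => i.
  by case: (HP i) => [all_i|[b Hb]]; [exists 0%N; left | exists b; right].
exists (\sum_i B i)%N => i; case: (HB i) => [all_i|Hb]; [by left | right=> j /Hb le_j].
by apply: leq_trans le_j _; rewrite (bigD1 i) //= leq_addr.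
Qed.

Lemma exists_least (P : nat -> Prop) :
  (exists n, P n) -> exists n, P n /\ forall k, P k -> (n <= k)%N.
Proof.
case=> n; elim/ltn_ind: n => n IH Pn.
case: (classic (exists2 k, (k < n)%N & P k)) => [[k lt_k Pk]|least]; first exact: IH Pk.
exists n; split=> // k Pk; rewrite leqNgt; apply/negP => lt_k.
by apply: least; exists k.
Qed.

Section VirtualPeriod.

Local Open Scope nat_scope.

Variables (T : Type) (b : nat -> T).

Lemma periodic_from_muln N r q k :
  periodic_from b N r -> N <= k -> b k = b (k + q * r).
Proof.
move=> per Nk; elim: q => [|q IH]; first by rewrite addn0.
by rewrite IH per ?(leq_trans Nk) ?leq_addr // -addnA mulSnr.
Qed.

(** The least period r and the least starting point N are obtained separately. A nonzero R mod r
    would be a smaller eventual period, so r divides R. *)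
Lemma virtual_period_exists N0 R : 0 < N0 -> 0 < R -> periodic_from b N0 R ->
  exists r N, [/\ is_virtual_period b r, r %| R, is_preperiod_length b N &
    periodic_from b N r].
Proof.
move=> N0_gt0 R_gt0 per.
have [|r [[r0 [Nr Nr0 per_r]] min_r]] := @exists_least (fun r => 1 <= r /\
    exists2 N, 1 <= N & periodic_from b N r).
  by exists R; split=> //; exists N0.
have [|N [[N_gt0 [r' r'0 per_N]] min_N]] := @exists_least (fun N => 1 <= N /\
    exists2 r, 1 <= r & periodic_from b N r).
  by exists N0; split=> //; exists R.
exists r, N; split.
- by split=> //; split=> //; exists Nr.
- rewrite /dvdn; apply/negPn/negP; rewrite -lt0n => t0.
  have := ltn_pmod R r0; rewrite ltnNge => /negP; apply; apply: min_r; split=> //.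
  exists (maxn Nr N0); first by rewrite leq_max Nr0.
  move=> k; rewrite geq_max => /andP[Nrk N0k]; rewrite per // {1}(divn_eq R r).
  rewrite [_ * r + _]addnC addnA -(periodic_from_muln _ per_r) //.
  exact: leq_trans Nrk (leq_addr _ _).
- by split=> //; split=> //; exists r'.
(* To see that r works already from N: move beyond Nr by a multiple of r', apply the period r there,
   and move back. *)
move=> k Nk; rewrite (periodic_from_muln Nr per_N Nk) per_r; last first.
  by rewrite (leq_trans _ (leq_addl _ _)) // leq_pmulr.
by rewrite addnAC -(periodic_from_muln _ per_N) // (leq_trans Nk) ?leq_addr.
Qed.

End VirtualPeriod.

Local Close Scope ring_scope.

Theorem theorem1p2 (m n : nat) (hm : (1 <= m)%N) (hn : (1 <= n)%N)
    (L : fieldExtType rat) (hL : is_cyclotomic_field m L)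
    (a : nat -> L) (ha : linear_recurrence n a) :
  (exists s : nat,
     [/\ (0 < s)%N, (s %| R_number m n)%N &
       exists F I : seq nat, forall k : nat,
         a k = 0%R <->
         k \in F \/ exists2 i : nat, i \in I & exists j : nat, k = (i + s * j)%N])
  /\
  (virtually_periodic (fun k => gen_field (a k)) /\
   exists r N : nat,
     [/\ is_virtual_period (fun k => gen_field (a k)) r,
         (r %| R_number m n)%N,
         is_preperiod_length (fun k => gen_field (a k)) N &
         forall k k' : nat, k = k' %[mod r] -> (N <= k')%N ->
           (gen_field (a k) <= gen_field (a k'))%VS]).
Proof.
have [z zm gen_z] := cyclotomic_generator hm hL.
have [G [phi galP]] := cyclotomic_galois hm hL.
case: ha => c nz_c rec.
(* For odd m, m' is 2m, which matches the definition of [R_number] and keeps z^m' = 1. *)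
have [m' [m'_gt0 m'_even zm' ->]] : exists m', [/\ (0 < m')%N, (2 %| m')%N,
    (z ^+ m' = 1)%R & R_number m n = R_even m' n].
  rewrite /R_number; have [odd_m|even_m] := boolP (odd m).
    by exists (2 * m)%N; rewrite muln_gt0 hm dvdn_mulr // mulnC exprM zm expr1n.
  by exists m; rewrite dvdn2 even_m.
set R := R_even m' n; have R0 : (0 < R)%N := R_even_gt0 n m'_gt0.
have divR k : k = (k %% R + R * (k %/ R))%N by rewrite addnC mulnC -divn_eq.
split.
  exists R; split=> //.
  have [B HB] := @uniform_bound 'I_R _ (fun i =>
    zero_dichotomy m'_gt0 m'_even hn zm' gen_z nz_c rec i).
  (* On a class with finitely many zeros B bounds their index j, so a zero at j = B + 1 detects the
     classes that vanish identically; all other zeros lie below R (B + 1). *)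
  exists [seq k <- iota 0 (R * B.+1) | a k == 0%R].
  exists [seq i <- iota 0 R | a (i + R * B.+1)%N == 0%R] => k; split=> [ak0|].
    pose i := Ordinal (ltn_pmod k R0); case: (HB i) => [all0|le_B].
      right; exists (k %% R)%N; last by exists (k %/ R)%N; apply: divR.
      by rewrite mem_filter mem_iota ltn_pmod // (all0 B.+1) eqxx.
    left; rewrite mem_filter ak0 eqxx mem_iota /= add0n mulnC -ltn_divLR // ltnS.
    by apply: le_B; rewrite /= -/R -divR.
  case=> [|[i + [j ->]]]; rewrite mem_filter; first by case/andP=> /eqP.
  rewrite mem_iota add0n => /andP[/eqP ai0 /= lt_i].
  case: (HB (Ordinal lt_i)) => [->//|le_B].
  by have := le_B _ ai0; rewrite ltnn.
have [B HB] := @uniform_bound (G * 'I_R)%type _ (fun gi =>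
  fix_dichotomy m'_gt0 m'_even hn zm' gen_z nz_c rec (phi gi.1) gi.2).
pose b k := gen_field (a k); pose N0 := (R * B.+1)%N.
(* An automorphism fixing a term of index at least N0 is past the bound B, so it fixes the whole
   class modulo R, including terms before N0. *)
have incl k k' : k = k' %[mod R] -> (N0 <= k')%N -> (b k <= b k')%VS.
  move=> kk' le_k'; apply: galP => g fix_k'; pose i := Ordinal (ltn_pmod k' R0).
  case: (HB (g, i)) => [fix_all|le_B].
    by rewrite (divR k) kk'; apply: fix_all.
  have := le_B (k' %/ R)%N; rewrite /= -/R -divR => /(_ fix_k').
  by rewrite leqNgt leq_divRL // mulnC le_k'.
have per : periodic_from b N0 R.
  move=> k le_k; apply/val_inj/eqP; rewrite eqEsubv /=.
  by rewrite !incl ?modnDr // (leq_trans le_k) ?leq_addr.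
have N0_gt0 : (0 < N0)%N by rewrite muln_gt0 R0.
split; first by exists N0, R.
have [r [N [vp dvd_r pp per_r]]] := virtual_period_exists N0_gt0 R0 per.
exists r, N; split=> // k k' kk' le_k'.
(* k2 is congruent to k modulo R and to k' modulo r, and is at least k' and N0: the period r carries
   k' to k2, where the inclusion modulo R applies. *)
pose k2 := (k + R * (k' + N0))%N.
have le_k2 : (k' <= k2)%N.
  rewrite (leq_trans _ (leq_addl _ _)) // (leq_trans (leq_addr N0 _)) //.
  by rewrite leq_pmull.
have /dvdnP[q Dq] : (r %| k2 - k')%N.
  have dvd_k2 : r %| R * (k' + N0) by rewrite dvdn_mulr.
  by rewrite -eqn_mod_dvd // /k2 -modnDmr (eqP dvd_k2) addn0 kk'.
have -> : gen_field (a k') = b k2.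
  by rewrite -[k2](subnKC le_k2) Dq; apply: periodic_from_muln per_r le_k'.
apply: incl; first by rewrite /k2 addnC mulnC modnMDl.
rewrite (leq_trans _ (leq_addl _ _)) // (leq_trans (leq_addl k' _)) //.
by rewrite leq_pmull.
Qed.
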